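(* Let $q\in(0,1)$ and let $(R_n(x;q))_{n\in\mathbb{N}_0}$ be the little $q$-Legendre polynomials, with Haar weights $h(n)=\frac{1}{q^n}\frac{1-q^{2n+1}}{1-q}$. For $x\in\mathbb{R}$ let $\alpha_x:\mathbb{N}_0\to\mathbb{R}$, $\alpha_x(k)=R_k(x;q)$, and for $p\in\{1,2\}$ let $\|f\|_p=\left(\sum_{k=0}^\infty|f(k)|^p h(k)\right)^{1/p}$. Then there is some $C>0$ such that \[0<\|\alpha_{1-q^n}\|_2^2<\|\alpha_{1-q^n}\|_1<C\|\alpha_{1-q^n}\|_2^2\] for all $n\in\mathbb{N}_0$. It is possible to take \[C=\frac{1}{q^{K}}\left[\frac{1}{1-q}+\frac{1}{1-q^{2K+1}}\sum_{k=1}^\infty4^k q^{\frac{(2K+k-1)k}{2}}\right],\qquad K=\left\lceil\frac{\log4}{\log\frac{1}{q}}-1\right\rceil.\]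
   Context: For $q\in(0,1)$, the little $q$-Legendre polynomials are defined by $R_0(x;q)=1$, $R_1(x;q)=(x-b_0)/a_0$ and $R_1(x;q)R_n(x;q)=a_nR_{n+1}(x;q)+b_nR_n(x;q)+c_nR_{n-1}(x;q)$ for $n\ge1$, where $a_0=\frac{1}{q+1}$, $b_0=\frac{q}{q+1}$, and for $n\ge1$: $a_n=q^n\frac{(1+q)(1-q^{n+1})}{(1-q^{2n+1})(1+q^{n+1})}$, $c_n=q^n\frac{(1+q)(1-q^n)}{(1-q^{2n+1})(1+q^n)}$, $b_n=1-a_n-c_n=\frac{(1-q^n)(1-q^{n+1})}{(1+q^n)(1+q^{n+1})}$. Equivalently $R_n(x;q)=\sum_{k=0}^n\frac{(q^{-n};q)_k(q^{n+1};q)_k}{(q;q)_k^2}(q-qx)^k$. They satisfy $R_n(1;q)=1$ and are orthogonal with respect to the probability measure $\mu$ with $\mu(\{1-q^n\})=q^n(1-q)$ ($n\in\mathbb{N}_0$). The functions $\alpha_{1-q^n}$ belong to $\ell^1(h)$. *)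

(* Defs.v *)
From Stdlib Require Import Reals ZArith.
From Coquelicot Require Import Coquelicot.
Open Scope R_scope.

Definition a0 (q : R) : R := 1 / (q + 1).
Definition b0 (q : R) : R := q / (q + 1).
(* for n >= 1 *)
Definition an (q : R) (n : nat) : R :=
  q ^ n * ((1 + q) * (1 - q ^ (n + 1))) / ((1 - q ^ (2 * n + 1)) * (1 + q ^ (n + 1))).
Definition cn (q : R) (n : nat) : R :=
  q ^ n * ((1 + q) * (1 - q ^ n)) / ((1 - q ^ (2 * n + 1)) * (1 + q ^ n)).
Definition bn (q : R) (n : nat) : R := 1 - an q n - cn q n.

Definition R1 (q x : R) : R := (x - b0 q) / a0 q.

(* Rpair q x n = (R_n(x;q), R_{n+1}(x;q)), using
   R_1 R_m = a_m R_{m+1} + b_m R_m + c_m R_{m-1}  (m >= 1). *)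
Fixpoint Rpair (q x : R) (n : nat) : R * R :=
  match n with
  | O => (1, R1 q x)
  | S m =>
      let (u, v) := Rpair q x m in
      (v, ((R1 q x - bn q (S m)) * v - cn q (S m) * u) / an q (S m))
  end.

Definition qLeg (q : R) (n : nat) (x : R) : R := fst (Rpair q x n).

Definition alpha (q x : R) (k : nat) : R := qLeg q k x.

Definition hw (q : R) (n : nat) : R := / q ^ n * ((1 - q ^ (2 * n + 1)) / (1 - q)).

Definition lsum1 (q : R) (f : nat -> R) : R := Series (fun k => Rabs (f k) * hw q k).
Definition lsum2 (q : R) (f : nat -> R) : R := Series (fun k => Rabs (f k) ^ 2 * hw q k).

Definition norm1 (q : R) (f : nat -> R) : R := lsum1 q f.
Definition norm2 (q : R) (f : nat -> R) : R := sqrt (lsum2 q f).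

Definition Rceil (x : R) : Z := (1 - up (- x))%Z.

Definition Kq (q : R) : Z := Rceil (ln 4 / ln (1 / q) - 1).

Definition Cq (q : R) : R :=
  let K := IZR (Kq q) in
  / Rpower q K *
  (1 / (1 - q) +
   1 / (1 - Rpower q (2 * K + 1)) *
   Series (fun m => let k := INR (S m) in
                    4 ^ (S m) * Rpower q ((2 * K + k - 1) * k / 2))).

(* Main.v *)
Require Import Defs.
From Stdlib Require Import Reals ZArith Lra Lia.
From Coquelicot Require Import Coquelicot.
Open Scope R_scope.

(**
Write f_n(k) = R_k(1 - q^n). Besides the three-term recurrence in k, f satisfies a second-order q-difference equation in n.

The decay of f_n(k) in k is explicit for n = 0, where f_0(k) = (-1)^k q^(k(k+1)/2), and the equation in n propagates it to all n. Summation by parts with the recurrence in k makes the f_n orthogonal in l^2(h); the equation in n then gives |f_(n+1)|^2 = |f_n|^2 / q, so |f_n|^2 = 1 / (q^n (1 - q)).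

The bound |f_n(k)| <= 1, for fixed k, comes from a nonnegative kernel in (y, z) that commutes with the birth-death operator of rates q^y (1 - q^(y+1)) and q^y (1 - q^y): its rows all have the same sum, which is 1 in the limit y -> oo, and its diagonal is f_y(k)^2. Off the diagonal the kernel is a weight times the square of an iterated q-difference of f in n (this is the degree-zero part of the addition formula).

Finally, for m > n + K the recurrence in k, read backwards from infinity, gives |f_n(m)| <= 4 q^(m-n) |f_n(m-1)|. Splitting the l^1 sum at n + K and using |f_n| <= 1 below yields the constant.
*)

(** * Recurrences in the degree and in the node *)

(** Up to the factor (1+q)/(1-q) this is [hw q m * cn q m], the conductance between the degrees m-1
    and m; it puts the recurrence in the degree into divergence form. *)
Definition gq (q : R) (m : nat) : R := (1 - q ^ m) / (1 + q ^ m).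

(* q^-(k-j) (1 - q^(k-j)) (1 - q^(k+j+1)), without the subtraction [k - j]; this is the eigenvalue of the j-th iterated difference of R_k. *)
Definition lam (q : R) (k j : nat) : R :=
  (q ^ j - q ^ k) / q ^ k * (1 - q ^ (k + j + 1)).

Definition leg (q : R) (n k : nat) : R := qLeg q k (1 - q ^ n).

Lemma pow_lt_one (q : R) (n : nat) : 0 < q < 1 -> (0 < n)%nat -> q ^ n < 1.
Proof.
  intros Hq Hn. destruct n as [|n]; [lia|].
  apply pow_lt_1_compat; [lra | lia].
Qed.

Lemma pow_le_one (q : R) (n : nat) : 0 < q < 1 -> q ^ n <= 1.
Proof. intros Hq. rewrite <- (pow1 n). apply pow_incr; lra. Qed.

Lemma Rpair_qLeg (q x : R) (k : nat) : Rpair q x k = (qLeg q k x, qLeg q (S k) x).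
Proof.
  unfold qLeg; simpl. destruct (Rpair q x k); reflexivity.
Qed.

Lemma qLeg_SS (q x : R) (k : nat) :
  qLeg q (S (S k)) x =
    ((Defs.R1 q x - bn q (S k)) * qLeg q (S k) x - cn q (S k) * qLeg q k x) / an q (S k).
Proof.
  unfold qLeg at 1. simpl. rewrite (Rpair_qLeg q x k). reflexivity.
Qed.

Lemma qLeg_rec0 (q x : R) : 0 < q < 1 ->
  gq q 1 * (qLeg q 1 x - qLeg q 0 x) = - (1 - x) * (1 - q) * qLeg q 0 x.
Proof.
  intros Hq. unfold gq, qLeg; simpl. unfold Defs.R1, a0, b0. field. lra.
Qed.

(** This is the three-term recurrence multiplied by [hw]: as a_k + b_k + c_k = 1 and R_1(x) - 1 =
    -(1+q)(1-x), only differences of consecutive R_k and a term with 1 - x survive. *)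
Lemma qLeg_rec (q x : R) (k : nat) : 0 < q < 1 ->
  gq q (S (S k)) * (qLeg q (S (S k)) x - qLeg q (S k) x) =
  gq q (S k) * (qLeg q (S k) x - qLeg q k x)
    - (1 - x) * (/ q ^ S k - q ^ S (S k)) * qLeg q (S k) x.
Proof.
  intros Hq. rewrite qLeg_SS.
  assert (HP : 0 < q ^ k) by (apply pow_lt; lra).
  assert (HP1 : q ^ k <= 1) by (apply pow_le_one; lra).
  unfold gq, bn, an, cn, Defs.R1, a0, b0.
  replace (2 * S k + 1)%nat with (k + k + 3)%nat by lia.
  replace (S k + 1)%nat with (S (S k)) by lia.
  rewrite !pow_add. simpl.
  set (P := q ^ k) in *. clearbody P. set (u := qLeg q (S k) x). set (v := qLeg q k x).
  assert (q * P < 1) by nra. assert (q * (q * P) < 1) by nra.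
  assert (0 < q * P) by nra. assert (0 < q * (q * P)) by nra.
  assert (P * P * (q * (q * (q * 1))) < 1).
  { replace (P * P * (q * (q * (q * 1)))) with (q * P * (q * (q * P))) by ring. nra. }
  field. repeat split; lra.
Qed.

Lemma leg_rec0 (q : R) (n : nat) : 0 < q < 1 ->
  gq q 1 * (leg q n 1 - leg q n 0) = - q ^ n * (1 - q) * leg q n 0.
Proof.
  intros Hq. unfold leg. rewrite qLeg_rec0 by assumption. ring.
Qed.

Lemma leg_rec (q : R) (n k : nat) : 0 < q < 1 ->
  gq q (S (S k)) * (leg q n (S (S k)) - leg q n (S k)) =
  gq q (S k) * (leg q n (S k) - leg q n k)
    - q ^ n * (/ q ^ S k - q ^ S (S k)) * leg q n (S k).
Proof.
  intros Hq. unfold leg. rewrite qLeg_rec by assumption. ring.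
Qed.

(* By induction on [k]: the shift n -> n+1 acts on the pairs (R_k, R_{k+1}) by 2x2 matrices that commute with the shift k -> k+1. *)
Lemma leg_shift (q : R) (n k : nat) : 0 < q < 1 ->
  (1 - q ^ S n) * (leg q (S n) k - leg q n k) =
    - gq q (S k) * (leg q n (S k) - leg q n k)
    - / q ^ k * (1 - q ^ S k) * q ^ n * leg q n k /\
  (1 - q ^ S n) * (leg q (S n) (S k) - leg q n (S k)) =
    - gq q (S k) * (leg q n (S k) - leg q n k)
    + q * (1 - q ^ S k) * q ^ n * leg q n (S k).
Proof.
  intros Hq. induction k as [|k [IH1 IH2]].
  - unfold leg, qLeg, gq; simpl. unfold Defs.R1, a0, b0.
    assert (0 < q ^ n) by (apply pow_lt; lra). split; field; lra.
  - assert (HP : 0 < q ^ k) by (apply pow_lt; lra).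
    assert (HP1 : q ^ k <= 1) by (apply pow_le_one; lra).
    assert (HN : 0 < q ^ n) by (apply pow_lt; lra).
    assert (HN1 : q ^ n <= 1) by (apply pow_le_one; lra).
    pose proof (leg_rec q n k Hq) as E.
    pose proof (leg_rec q (S n) k Hq) as E'.
    revert E E' IH1 IH2. unfold gq. simpl.
    set (P := q ^ k) in *. set (N := q ^ n) in *. clearbody P N.
    set (a := leg q n k). set (b := leg q n (S k)). set (c := leg q n (S (S k))).
    set (a' := leg q (S n) k). set (b' := leg q (S n) (S k)). set (c' := leg q (S n) (S (S k))).
    clearbody a b c a' b' c'.
    intros E E' IH1 IH2.
    assert (q * P < 1) by nra. assert (q * (q * P) < 1) by nra.
    assert (0 < q * P) by nra. assert (0 < q * (q * P)) by nra.
    assert (q * N < 1) by nra.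
    (* Everything is expressed through [a] and [b], so that both claims become identities of
       rational functions. *)
    assert (Ha : a' = a + (- ((1 - q * P) / (1 + q * P)) * (b - a) - / P * (1 - q * P) * N * a) / (1 - q * N)).
    { rewrite <- IH1. field. lra. }
    assert (Hb : b' = b + (- ((1 - q * P) / (1 + q * P)) * (b - a) + q * (1 - q * P) * N * b) / (1 - q * N)).
    { rewrite <- IH2. field. lra. }
    assert (Hc : c = b + ((1 - q * P) / (1 + q * P) * (b - a) - N * (/ (q * P) - q * (q * P)) * b) * (1 + q * (q * P)) / (1 - q * (q * P))).
    { rewrite <- E. field. split; lra. }
    assert (Hc' : c' = b' + ((1 - q * P) / (1 + q * P) * (b' - a') - q * N * (/ (q * P) - q * (q * P)) * b') * (1 + q * (q * P)) / (1 - q * (q * P))).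
    { rewrite <- E'. field. split; lra. }
    clear E E' IH1 IH2. rewrite Hc', Ha, Hb, Hc.
    split; field; repeat split; lra.
Qed.

(** The sequence (-1)^k q^(k(k+1)/2) solves the second-order recurrence at the node x = 0, so the
    induction only substitutes one first-order step into it. *)
Lemma leg_at_zero (q : R) (k : nat) : 0 < q < 1 -> leg q 0 (S k) = - q ^ S k * leg q 0 k.
Proof.
  intros Hq. induction k as [|k IH].
  - unfold leg, qLeg; simpl. unfold Defs.R1, a0, b0. field. lra.
  - assert (HP : 0 < q ^ k) by (apply pow_lt; lra).
    assert (HP1 : q ^ k <= 1) by (apply pow_le_one; lra).
    pose proof (leg_rec q 0 k Hq) as E. revert E. unfold gq. rewrite IH. simpl.
    set (P := q ^ k) in *. clearbody P.
    set (a := leg q 0 k). set (c := leg q 0 (S (S k))). clearbody a c.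
    assert (q * (q * P) < 1) by nra.
    assert (0 < q * P) by nra. assert (0 < q * (q * P)) by nra.
    intros E.
    assert (Hc : c = - (q * P) * a + ((1 - q * P) / (1 + q * P) * (- (q * P) * a - a) - 1 * (/ (q * P) - q * (q * P)) * (- (q * P) * a)) * (1 + q * (q * P)) / (1 - q * (q * P))).
    { rewrite <- E. field. split; lra. }
    rewrite Hc. field. repeat split; lra.
Qed.

(* At [n = 0] the junk value [pred 0 = 0] is harmless: its coefficient vanishes. *)
Lemma leg_diff_eq (q : R) (k n : nat) : 0 < q < 1 ->
  (1 - q ^ S n) * (leg q (S n) k - leg q n k)
    - (1 - q ^ n) * (leg q n k - leg q (pred n) k) =
  - lam q k 0 * q ^ n * leg q n k.
Proof.
  intros Hq.
  assert (HP : 0 < q ^ k) by (apply pow_lt; lra).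
  assert (HP1 : q ^ k <= 1) by (apply pow_le_one; lra).
  destruct n as [|n].
  - rewrite (proj1 (leg_shift q 0 k Hq)), leg_at_zero by assumption.
    unfold lam, gq. rewrite Nat.add_0_r, Nat.add_1_r. simpl.
    assert (0 < q * q ^ k) by nra.
    field. lra.
  - rewrite (proj1 (leg_shift q (S n) k Hq)). simpl pred.
    destruct (leg_shift q n k Hq) as [E1 E2].
    assert (HN : 0 < q ^ n) by (apply pow_lt; lra).
    assert (HN1 : q ^ n <= 1) by (apply pow_le_one; lra).
    revert E1 E2. unfold lam, gq. rewrite Nat.add_0_r, Nat.add_1_r. simpl.
    set (P := q ^ k) in *. set (N := q ^ n) in *. clearbody P N.
    set (a := leg q n k). set (b := leg q n (S k)).
    set (a' := leg q (S n) k). set (b' := leg q (S n) (S k)).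
    clearbody a b a' b'. intros E1 E2.
    assert (0 < q * P) by nra. assert (q * N < 1) by nra.
    assert (Ha : a' = a + (- ((1 - q * P) / (1 + q * P)) * (b - a) - / P * (1 - q * P) * N * a) / (1 - q * N)).
    { rewrite <- E1. field. lra. }
    assert (Hb : b' = b + (- ((1 - q * P) / (1 + q * P)) * (b - a) + q * (1 - q * P) * N * b) / (1 - q * N)).
    { rewrite <- E2. field. lra. }
    rewrite Ha, Hb. field. repeat split; lra.
Qed.

(** * The bound |R_k(1 - q^n)| <= 1 *)

(** The nodes 1 - q^y have spacing q^y (1 - q), so up to the factor (1 - q)^j this is the j-th
    q-derivative. *)
Fixpoint qdiff (q : R) (f : nat -> R) (j : nat) : nat -> R :=
  match j with
  | O => f
  | S j' => fun y => (qdiff q f j' (S y) - qdiff q f j' y) / q ^ y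
  end.

(** The equation of hypergeometric type for the j-th difference; j = 0 is the q-difference equation
    in the node times -q / q^y. At y = 0 the coefficient of the [pred y] term vanishes. *)
Definition ladder (q : R) (k : nat) (f : nat -> R) (j : nat) : Prop :=
  forall y, (1 - q ^ y) * qdiff q f (S j) (pred y)
    - q ^ S j * (1 - q ^ (y + j + 1)) * qdiff q f (S j) y = q * lam q k j * qdiff q f j y.

Lemma qdiff_step (q : R) (f : nat -> R) (j y : nat) : 0 < q ->
  qdiff q f j (S y) = qdiff q f j y + q ^ y * qdiff q f (S j) y.
Proof.
  intros Hq. simpl. field. apply pow_nonzero; lra.
Qed.

(** Differencing the equation of level j in y gives an equation of the same shape at level j + 1,
    with shifted coefficients and eigenvalue. *)
Lemma ladder_all (q : R) (k : nat) (j : nat) : 0 < q < 1 ->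
  ladder q k (fun n => leg q n k) j.
Proof.
  intros Hq. induction j as [|j IH]; intros y.
  - pose proof (leg_diff_eq q k y Hq) as E. simpl qdiff.
    destruct y as [|y]; simpl pred in *.
    + simpl. simpl in E. transitivity (- q * ((1 - q * 1) * (leg q 1 k - leg q 0 k) - (1 - 1) * (leg q 0 k - leg q 0 k))).
      * field.
      * rewrite E. ring.
    + assert (0 < q ^ y) by (apply pow_lt; lra).
      replace (S y + 0 + 1)%nat with (S (S y)) by lia.
      transitivity (- / q ^ y * ((1 - q ^ S (S y)) * (leg q (S (S y)) k - leg q (S y) k) -
        (1 - q ^ S y) * (leg q (S y) k - leg q y k))).
      * simpl. field. lra.
      * rewrite E. simpl. field. lra.
  - pose proof (IH y) as E1. pose proof (IH (S y)) as E2.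
    simpl pred in E2.
    assert (HP : 0 < q ^ y) by (apply pow_lt; lra).
    assert (HK : 0 < q ^ k) by (apply pow_lt; lra).
    set (u := qdiff q (fun n => leg q n k)) in *.
    assert (S1 : u j (S y) = u j y + q ^ y * u (S j) y) by (apply qdiff_step; lra).
    assert (S2 : u (S j) (S y) = u (S j) y + q ^ y * u (S (S j)) y) by (apply qdiff_step; lra).
    (* The factor 1 - q^y makes this step from [pred y] to [y] valid at y = 0 as well. *)
    assert (S3 : (1 - q ^ y) * u (S j) y * q = (1 - q ^ y) * (q * u (S j) (pred y) + q ^ y * u (S (S j)) (pred y))).
    { destruct y as [|y]; [simpl; ring|]. simpl pred.
      assert (S2' : u (S j) (S y) = u (S j) y + q ^ y * u (S (S j)) y) by (apply qdiff_step; lra).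
      rewrite S2'. simpl. ring. }
    rewrite S1, S2 in E2. clear S1 S2. clearbody u.
    revert E1 E2. unfold lam.
    replace (S y + j + 1)%nat with (S (S (y + j))) by lia.
    replace (y + S j + 1)%nat with (S (S (y + j))) by lia.
    replace (y + j + 1)%nat with (S (y + j)) by lia.
    replace (k + S j + 1)%nat with (S (S (k + j))) by lia.
    replace (k + j + 1)%nat with (S (k + j)) by lia.
    simpl. rewrite !pow_add. revert S3.
    set (Y := q ^ y) in *. set (J := q ^ j). set (K := q ^ k) in *. clearbody Y J K.
    set (a := u j y). set (b := u (S j) y). set (b' := u (S j) (pred y)).
    set (c := u (S (S j)) y). set (c' := u (S (S j)) (pred y)). clearbody a b b' c c'.
    clear u IH. intros S3 E1 E2.
    apply Rmult_eq_reg_l with Y; [|lra].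
    assert (E3 : q * ((J - K) / K * (1 - q * (K * J))) * (Y * b) =
      ((1 - q * Y) * b - q * J * (1 - q * (q * (Y * J))) * (b + Y * c)) -
      ((1 - Y) * b' - q * J * (1 - q * (Y * J)) * b)).
    { rewrite E1, E2. ring. }
    (* The shift of the eigenvalue: [lam q k (S j)] is q [lam q k j] - (1 - q)(1 - q^(2j+2)). *)
    assert (E4 : q * ((q * J - K) / K * (1 - q * (q * (K * J)))) =
       q * (q * ((J - K) / K * (1 - q * (K * J)))) - q * (1 - q) * (1 - q * q * J * J)).
    { field. lra. }
    rewrite E4.
    transitivity (q * (q * ((J - K) / K * (1 - q * (K * J))) * (Y * b)) - q * (1 - q) * (1 - q * q * J * J) * Y * b); [|ring].
    rewrite E3.
    transitivity ((1 - Y) * (q * b' + Y * c') - q * (1 - Y) * b' - Y * (q * (q * J) * (1 - q * (q * (Y * J))) * c)); [ring|].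
    rewrite <- S3. ring.
Qed.

(** As [lam q k k] is 0, level k of the ladder is a homogeneous first-order recurrence in y; it
    starts at 0 because of the coefficient 1 - q^0. This reflects that R_k has degree k. *)
Lemma qdiff_top (q : R) (k : nat) (y : nat) : 0 < q < 1 ->
  qdiff q (fun n => leg q n k) (S k) y = 0.
Proof.
  intros Hq. induction y as [|y IH].
  - pose proof (ladder_all q k k Hq 0%nat) as E. unfold lam in E.
    set (v := qdiff q (fun n => leg q n k) (S k)) in *. simpl pred in E.
    assert (q ^ (0 + k + 1) < 1) by (apply pow_lt_one; [lra | lia]).
    assert (0 < q ^ S k) by (apply pow_lt; lra).
    apply Rmult_eq_reg_l with (- q ^ S k * (1 - q ^ (0 + k + 1))); [|nra].
    simpl in *. lra.
  - pose proof (ladder_all q k k Hq (S y)) as E. unfold lam in E. simpl pred in E.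
    rewrite IH in E.
    set (v := qdiff q (fun n => leg q n k) (S k)) in *.
    assert (q ^ (S y + k + 1) < 1) by (apply pow_lt_one; [lra | lia]).
    assert (0 < q ^ S k) by (apply pow_lt; lra).
    apply Rmult_eq_reg_l with (- q ^ S k * (1 - q ^ (S y + k + 1))); [|nra].
    replace (q ^ k - q ^ k) with 0 in E by ring. unfold Rdiv in E. lra.
Qed.

Lemma qdiff_above (q : R) (k j y : nat) : 0 < q < 1 -> (k < j)%nat ->
  qdiff q (fun n => leg q n k) j y = 0.
Proof.
  intros Hq Hj. revert y. induction Hj as [|j Hj IH]; intros y.
  - apply qdiff_top, Hq.
  - simpl. rewrite !IH. unfold Rdiv. ring.
Qed.

(** * Weighted squares of the iterated differences and their wave equation *)

Fixpoint wgt (q : R) (k j y : nat) : R :=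
  match j with
  | O => q ^ y
  | S j' => wgt q k j' y * (q ^ (y + j') * (1 - q ^ S (y + j')) / lam q k j')
  end.

(** The kernel entry at (y, y + j). For j > k the weight involves a division by [lam q k k], which
    is 0, but the difference vanishes there. *)
Definition hsq (q : R) (k j y : nat) : R :=
  wgt q k j y * qdiff q (fun n => leg q n k) j y ^ 2.

Lemma lam_pos (q : R) (k j : nat) : 0 < q < 1 -> (j < k)%nat -> 0 < lam q k j.
Proof.
  intros Hq Hj. unfold lam.
  assert (0 < q ^ k) by (apply pow_lt; lra).
  assert (q ^ (k + j + 1) < 1) by (apply pow_lt_one; [lra | lia]).
  assert (q ^ k < q ^ j).
  { replace k with (j + (k - j))%nat by lia. rewrite pow_add.
    assert (0 < q ^ j) by (apply pow_lt; lra).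
    assert (q ^ (k - j) < 1) by (apply pow_lt_one; [lra | lia]). nra. }
  apply Rmult_lt_0_compat; [|lra]. apply Rdiv_lt_0_compat; lra.
Qed.

(** Up to a factor independent of y the weight is q^((j+1)y) (q^(y+1);q)_j, the little q-Jacobi
    weight that makes level j of the ladder symmetric; this is its ratio at consecutive nodes. *)
Lemma wgt_shift (q : R) (k j y : nat) :
  (1 - q ^ S y) * wgt q k j (S y) = q ^ S j * (1 - q ^ S (y + j)) * wgt q k j y.
Proof.
  induction j as [|j IH].
  - simpl. rewrite Nat.add_0_r. ring.
  - simpl wgt. rewrite <- Rmult_assoc, IH.
    replace (S y + j)%nat with (S (y + j)) by lia.
    replace (y + S j)%nat with (S (y + j)) by lia.
    unfold Rdiv. simpl. ring.
Qed.

Lemma wgt_nonneg (q : R) (k j y : nat) : 0 < q < 1 -> (j <= k)%nat -> 0 <= wgt q k j y.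
Proof.
  intros Hq. induction j as [|j IH]; intros Hj; simpl.
  - apply pow_le; lra.
  - apply Rmult_le_pos; [apply IH; lia|].
    pose proof (lam_pos q k j Hq Hj).
    assert (q ^ S (y + j) < 1) by (apply pow_lt_one; [lra | lia]).
    assert (0 < q ^ (y + j)) by (apply pow_lt; lra).
    apply Rlt_le, Rdiv_lt_0_compat; [|assumption]. simpl in *; nra.
Qed.

Lemma hsq_nonneg (q : R) (k j y : nat) : 0 < q < 1 -> 0 <= hsq q k j y.
Proof.
  intros Hq. unfold hsq. destruct (le_lt_dec j k) as [Hj|Hj].
  - apply Rmult_le_pos; [apply wgt_nonneg; assumption | apply pow2_ge_0].
  - rewrite qdiff_above by assumption. simpl. lra.
Qed.

Lemma hsq_above (q : R) (k j y : nat) : 0 < q < 1 -> (k < j)%nat -> hsq q k j y = 0.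
Proof.
  intros Hq Hj. unfold hsq. rewrite qdiff_above by assumption. ring.
Qed.

(** Both [up_rate q y / q ^ y] and [down_rate q (S y) / q ^ S y] equal 1 - q^(y+1), so these rates
    are reversible for the measure q^(-y). *)
Definition up_rate (q : R) (y : nat) : R := q ^ y * (1 - q ^ S y).
Definition down_rate (q : R) (y : nat) : R := q ^ y * (1 - q ^ y).

(** Level j + 1 of the ladder eliminates the difference at [pred y]; by the ratio of the weights the
    squares of the (j+2)-nd difference then cancel, and a cross term and a square of lower order
    remain. *)
Lemma hsq_outer (q : R) (k j y : nat) : 0 < q < 1 -> (j < k)%nat ->
  down_rate q y * hsq q k (S (S j)) (pred y) - up_rate q (y + S j) * hsq q k (S (S j)) y =
  wgt q k (S j) y * (q ^ y) ^ 2 *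
   (2 * q ^ S j * (1 - q ^ S (y + S j)) * qdiff q (fun n => leg q n k) (S (S j)) y
      * qdiff q (fun n => leg q n k) (S j) y
    + lam q k (S j) * qdiff q (fun n => leg q n k) (S j) y ^ 2).
Proof.
  intros Hq Hj. unfold hsq, up_rate, down_rate.
  pose proof (ladder_all q k (S j) Hq y) as E. unfold ladder in E.
  set (u := qdiff q (fun n => leg q n k)) in *.
  destruct (le_lt_dec k (S j)) as [Hk|Hk].
  (* At the top the (k+1)-st differences and [lam q k k] vanish, so both sides are 0. *)
  - assert (S j = k) by lia.
    assert (Z : forall z, u (S (S j)) z = 0) by (intros z; apply qdiff_above; [assumption|lia]).
    rewrite !Z. unfold lam. replace k with (S j) by lia. unfold Rdiv. ring.
  - pose proof (lam_pos q k (S j) Hq Hk) as L.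
    assert (HY : 0 < q ^ y) by (apply pow_lt; lra).
    assert (HJ : 0 < q ^ S j) by (apply pow_lt; lra).
    assert (Hlt : q ^ S (y + S j) < 1) by (apply pow_lt_one; [lra | lia]).
    replace (y + S j + 1)%nat with (S (y + S j)) in E by lia.
    assert (B : (1 - q ^ y) * u (S (S j)) (pred y) =
      q ^ S (S j) * (1 - q ^ S (y + S j)) * u (S (S j)) y + q * lam q k (S j) * u (S j) y) by lra.
    (* A second factor 1 - q^y lets the weight ratio at [pred y] cover y = 0 too. *)
    assert (W : (1 - q ^ y) * wgt q k (S (S j)) y * (1 - q ^ y) * u (S (S j)) (pred y) ^ 2 =
      q ^ S (S (S j)) * (1 - q ^ S (y + S j)) * ((1 - q ^ y) * wgt q k (S (S j)) (pred y)) * u (S (S j)) (pred y) ^ 2).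
    { destruct y as [|y]; [simpl; ring|]. simpl pred.
      rewrite (Rmult_assoc (1 - q ^ S y) _ (1 - q ^ S y)), (Rmult_comm _ (1 - q ^ S y)), wgt_shift.
      replace (S (y + S (S j))) with (S (S y + S j)) by lia. ring. }
    assert (W2 : q ^ S (S (S j)) * (1 - q ^ S (y + S j)) * (q ^ y * (1 - q ^ y) * (wgt q k (S (S j)) (pred y) * u (S (S j)) (pred y) ^ 2))
       = q ^ y * wgt q k (S (S j)) y * (q ^ S (S j) * (1 - q ^ S (y + S j)) * u (S (S j)) y + q * lam q k (S j) * u (S j) y) ^ 2).
    { rewrite <- B. transitivity (q ^ y * (q ^ S (S (S j)) * (1 - q ^ S (y + S j)) * ((1 - q ^ y) * wgt q k (S (S j)) (pred y)) * u (S (S j)) (pred y) ^ 2)); [ring|].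
      rewrite <- W. ring. }
    apply Rmult_eq_reg_l with (q ^ S (S (S j)) * (1 - q ^ S (y + S j))).
    2: { assert (0 < q ^ S (S (S j))) by (apply pow_lt; lra). nra. }
    rewrite Rmult_minus_distr_l, W2.
    change (wgt q k (S (S j)) y) with (wgt q k (S j) y * (q ^ (y + S j) * (1 - q ^ S (y + S j)) / lam q k (S j))).
    set (w := wgt q k (S j) y). set (b := u (S (S j)) y). set (U := u (S j) y).
    set (l := lam q k (S j)) in *. clearbody w b U l. clear - L.
    rewrite (pow_add q y (S j)), <- (tech_pow_Rmult q (S (S j))), <- (tech_pow_Rmult q (S j)).
    set (Y := q ^ y). set (J := q ^ S j).
    set (D := 1 - q ^ S (y + S j)).
    field. lra.
Qed.

(* The discrete wave equation: [hsq], read as a kernel in [(y, y + j)], commutes with the birth-death operator of rates [up_rate], [down_rate]. *)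
Lemma hsq_wave (q : R) (k j y : nat) : 0 < q < 1 ->
  up_rate q y * (hsq q k (S j) y - hsq q k j (S y))
    + down_rate q y * (hsq q k (S j) y - hsq q k (S (S j)) (pred y)) =
  up_rate q (y + S j) * (hsq q k (S j) y - hsq q k (S (S j)) y)
    + down_rate q (y + S j) * (hsq q k (S j) y - hsq q k j y).
Proof.
  intros Hq.
  assert (Q1 : up_rate q y * hsq q k j (S y) =
     q ^ y * q ^ S j * (1 - q ^ S (y + j)) * wgt q k j y * qdiff q (fun n => leg q n k) j (S y) ^ 2).
  { unfold up_rate, hsq.
    transitivity (q ^ y * ((1 - q ^ S y) * wgt q k j (S y)) * qdiff q (fun n => leg q n k) j (S y) ^ 2); [ring|].
    rewrite wgt_shift. ring. }
  assert (Q2 : down_rate q (y + S j) * hsq q k j y =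
     q ^ y * q ^ S j * (1 - q ^ S (y + j)) * wgt q k j y * qdiff q (fun n => leg q n k) j y ^ 2).
  { unfold down_rate, hsq. rewrite pow_add.
    replace (S (y + j)) with (y + S j)%nat by lia. rewrite !pow_add. ring. }
  assert (S1 := qdiff_step q (fun n => leg q n k) j y (proj1 Hq)).
  destruct (le_lt_dec k j) as [Hk|Hk].
  (* Only the squares of the j-th difference at y and [S y] remain, and these agree because the next
     difference is 0. *)
  - rewrite !(hsq_above q k (S j)), !(hsq_above q k (S (S j))) by (assumption || lia).
    rewrite (qdiff_above q k (S j)) in S1 by (assumption || lia).
    rewrite S1, Rmult_0_r, Rplus_0_r in Q1. lra.
  - pose proof (hsq_outer q k j y Hq Hk) as O.
    pose proof (lam_pos q k j Hq Hk) as L.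
    pose proof (ladder_all q k j Hq y) as E1.
    pose proof (ladder_all q k (S j) Hq y) as E2.
    assert (S3 : (1 - q ^ y) * qdiff q (fun n => leg q n k) (S j) y * q = (1 - q ^ y) *
      (q * qdiff q (fun n => leg q n k) (S j) (pred y) + q ^ y * qdiff q (fun n => leg q n k) (S (S j)) (pred y))).
    { destruct y as [|y]; [simpl; ring|]. simpl pred.
      rewrite (qdiff_step q _ (S j) y) by lra.
      rewrite <- (tech_pow_Rmult q y). ring. }
    assert (G : wgt q k (S j) y * lam q k j = wgt q k j y * q ^ (y + j) * (1 - q ^ S (y + j))).
    { simpl. field. lra. }
    rewrite S1 in Q1.
    unfold hsq at 1 3 5 7.
    set (u := qdiff q (fun n => leg q n k)) in *.
    enough (up_rate q y * (wgt q k (S j) y * u (S j) y ^ 2) + down_rate q y * (wgt q k (S j) y * u (S j) y ^ 2)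
      - (up_rate q y * hsq q k j (S y) - down_rate q (y + S j) * hsq q k j y)
      - (down_rate q y * hsq q k (S (S j)) (pred y) - up_rate q (y + S j) * hsq q k (S (S j)) y)
      - up_rate q (y + S j) * (wgt q k (S j) y * u (S j) y ^ 2) - down_rate q (y + S j) * (wgt q k (S j) y * u (S j) y ^ 2) = 0) by lra.
    rewrite O, Q1, Q2.
    assert (G2 : q ^ y * q ^ S j * (1 - q ^ S (y + j)) * wgt q k j y = wgt q k (S j) y * lam q k j * q).
    { rewrite G, pow_add. simpl. ring. }
    rewrite G2.
    assert (E4 : q * lam q k j = lam q k (S j) + (1 - q) * (1 - q ^ S j * q ^ S j)).
    { unfold lam. assert (0 < q ^ k) by (apply pow_lt; lra).
      rewrite !pow_add. simpl. field. lra. }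
    replace (y + j + 1)%nat with (y + S j)%nat in E1 by lia.
    replace (y + S j + 1)%nat with (S (y + S j))%nat in E2 by lia.
    unfold up_rate, down_rate. rewrite !pow_add.
    rewrite <- (tech_pow_Rmult q (y + S j)) in *. rewrite pow_add in *.
    rewrite <- (tech_pow_Rmult q (S j)) in *. rewrite <- (tech_pow_Rmult q y) in *.
    set (w := wgt q k (S j) y) in *. set (l := lam q k j) in *. set (l' := lam q k (S j)) in *.
    set (Y := q ^ y) in *. set (J := q ^ S j) in *.
    set (a := u j y) in *. set (b := u (S j) y) in *. set (b' := u (S j) (pred y)) in *.
    set (c := u (S (S j)) y) in *. set (c' := u (S (S j)) (pred y)) in *.
    clearbody w l l' Y J a b b' c c'. clear - Hq S3 E1 E2 E4.
    (* Levels j and j + 1 of the ladder combine to give [a] from [b] and [c] at the same node, free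
       of values at [pred y]; the claim then becomes a polynomial identity. *)
    assert (K1 : q * (q * l * a) = (1 - Y) * b * q - Y * (q * J * (1 - q * (Y * J)) * c + q * l' * b) - q * J * (1 - Y * J) * b).
    { rewrite <- E2, S3, <- E1. ring. }
    assert (K2 : q * l * a = (1 - Y) * b - Y * (J * (1 - q * (Y * J)) * c + l' * b) - J * (1 - Y * J) * b).
    { apply Rmult_eq_reg_l with q; [|lra]. rewrite K1. ring. }
    transitivity (w * (Y * (1 - q * Y) * b ^ 2 + Y * (1 - Y) * b ^ 2
       - (2 * Y * b * (q * l * a) + q * l * (Y * b) ^ 2)
       - Y ^ 2 * (2 * J * (1 - q * (Y * J)) * c * b + l' * b ^ 2)
       - Y * J * (1 - q * (Y * J)) * b ^ 2 - Y * J * (1 - Y * J) * b ^ 2)); [ring|].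
    rewrite K2, E4. ring.
Qed.

(** * The symmetric kernel and its constant row sums *)

Definition kern (q : R) (k y z : nat) : R :=
  if le_lt_dec y z then hsq q k (z - y) y else hsq q k (y - z) z.

Lemma kern_up (q : R) (k y j : nat) : kern q k y (y + j) = hsq q k j y.
Proof.
  unfold kern. destruct (le_lt_dec y (y + j)) as [_|H]; [|lia].
  f_equal; lia.
Qed.

Lemma kern_sym (q : R) (k y z : nat) : kern q k y z = kern q k z y.
Proof.
  unfold kern. destruct (le_lt_dec y z), (le_lt_dec z y); try lia; try reflexivity.
  replace z with y by lia. reflexivity.
Qed.

Lemma kern_nonneg (q : R) (k y z : nat) : 0 < q < 1 -> 0 <= kern q k y z.
Proof.
  intros Hq. unfold kern. destruct (le_lt_dec y z); apply hsq_nonneg, Hq.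
Qed.

Lemma kern_far (q : R) (k y z : nat) : 0 < q < 1 -> (y + k < z)%nat -> kern q k y z = 0.
Proof.
  intros Hq H. replace z with (y + (z - y))%nat by lia. rewrite kern_up.
  apply hsq_above; [assumption|lia].
Qed.

Definition birth_death (q : R) (h : nat -> R) (y : nat) : R :=
  up_rate q y * (h y - h (S y)) + down_rate q y * (h y - h (pred y)).

(** Above the diagonal this is the wave equation for [hsq]; symmetry of the kernel carries it below
    and settles y = z. *)
Lemma kern_wave (q : R) (k y z : nat) : 0 < q < 1 ->
  birth_death q (fun s => kern q k s z) y = birth_death q (fun s => kern q k y s) z.
Proof.
  intros Hq.
  assert (W : forall y j, birth_death q (fun s => kern q k s (y + S j)) y =
      birth_death q (fun s => kern q k y s) (y + S j)).
  { intros x j. unfold birth_death.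
    replace (kern q k x (S (x + S j))) with (hsq q k (S (S j)) x)
      by (rewrite <- kern_up; f_equal; lia).
    replace (kern q k x (pred (x + S j))) with (hsq q k j x)
      by (rewrite <- kern_up; f_equal; lia).
    replace (kern q k (S x) (x + S j)) with (hsq q k j (S x))
      by (rewrite <- kern_up; f_equal; lia).
    rewrite kern_up, <- hsq_wave by assumption.
    (* At x = 0 the vanishing [down_rate] removes the terms with [pred 0]. *)
    destruct x as [|x].
    - unfold down_rate. simpl. ring.
    - replace (kern q k (pred (S x)) (S x + S j)) with (hsq q k (S (S j)) (pred (S x)))
        by (rewrite <- kern_up; f_equal; lia).
      reflexivity. }
  destruct (lt_eq_lt_dec y z) as [[H|H]|H].
  - replace z with (y + S (z - y - 1))%nat by lia. apply W.
  - subst z. unfold birth_death. rewrite (kern_sym q k (S y) y), (kern_sym q k (pred y) y).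
    reflexivity.
  - replace y with (z + S (y - z - 1))%nat by lia.
    specialize (W z (y - z - 1)%nat). unfold birth_death in *.
    rewrite !(kern_sym q k _ z), !(kern_sym q k (z + S (y - z - 1))%nat). symmetry. exact W.
Qed.

(** By reversibility the summands are differences of fluxes and telescope; the flux below 0 carries
    the factor 1 - q^0. *)
Lemma birth_death_sum (q : R) (h : nat -> R) (N : nat) : 0 < q ->
  sum_f_R0 (fun s => birth_death q h s / q ^ s) N = (1 - q ^ S N) * (h N - h (S N)).
Proof.
  intros Hq.
  assert (E : forall s, birth_death q h s / q ^ s =
    (1 - q ^ S s) * (h s - h (S s)) + (1 - q ^ s) * (h s - h (pred s))).
  { intros s. unfold birth_death, up_rate, down_rate. field. apply pow_nonzero; lra. }
  induction N as [|N IH].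
  - simpl sum_f_R0. rewrite E. simpl. ring.
  - rewrite tech5, IH, E. simpl pred. ring.
Qed.

Definition rowsum (q : R) (k N y : nat) : R := sum_f_R0 (fun s => kern q k y s / q ^ s) N.

(** Commutation moves the operator from the row index to the summation index, where it telescopes to
    a flux at N, outside the band in which the kernel lives. *)
Lemma rowsum_harmonic (q : R) (k N y : nat) : 0 < q < 1 -> (y + k < N)%nat ->
  birth_death q (rowsum q k N) y = 0.
Proof.
  intros Hq HN.
  transitivity (sum_f_R0 (fun s => birth_death q (fun t => kern q k y t) s / q ^ s) N).
  - rewrite (sum_eq _ (fun s => birth_death q (fun t => kern q k t s) y / q ^ s))
      by (intros s _; rewrite kern_wave by assumption; reflexivity).
    unfold rowsum, birth_death. rewrite <- !minus_sum, !scal_sum, <- plus_sum.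
    apply sum_eq. intros s _. unfold Rdiv. ring.
  - rewrite birth_death_sum by lra. rewrite !(kern_far q k y) by (assumption || lia). ring.
Qed.

(** There is no downward rate at 0, so harmonicity forces equality of the first two values and then,
    step by step, of all the others. *)
Lemma rowsum_step (q : R) (k N y : nat) : 0 < q < 1 -> (y + k < N)%nat ->
  rowsum q k N (S y) = rowsum q k N y.
Proof.
  intros Hq. induction y as [|y IH]; intros HN; pose proof (rowsum_harmonic q k N _ Hq HN) as E;
    unfold birth_death in E.
  - assert (0 < up_rate q 0) by (unfold up_rate; simpl; lra).
    unfold down_rate in E. simpl in E. nra.
  - simpl pred in E. rewrite (IH ltac:(lia)) in E.
    assert (0 < up_rate q (S y)).
    { unfold up_rate. assert (0 < q ^ S y) by (apply pow_lt; lra).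
      assert (q ^ S (S y) < 1) by (apply pow_lt_one; [lra | lia]). nra. }
    rewrite (IH ltac:(lia)). nra.
Qed.

Lemma rowsum_const (q : R) (k N y m : nat) : 0 < q < 1 -> (y <= m)%nat -> (m + k <= N)%nat ->
  rowsum q k N y = rowsum q k N m.
Proof.
  intros Hq Hm. induction Hm as [|m Hm IH]; intros HN; [reflexivity|].
  rewrite rowsum_step by (assumption || lia). apply IH. lia.
Qed.

Lemma sum_ge_term (a : nat -> R) (N n : nat) :
  (forall i, 0 <= a i) -> (n <= N)%nat -> a n <= sum_f_R0 a N.
Proof.
  intros Ha Hn. induction Hn as [|N Hn IH].
  - destruct n; simpl; [lra|]. pose proof (cond_pos_sum a n Ha). lra.
  - simpl. pose proof (Ha (S N)). lra.
Qed.

Lemma kern_diag (q : R) (k y : nat) : 0 < q -> kern q k y y / q ^ y = leg q y k ^ 2.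
Proof.
  intros Hq. replace (kern q k y y) with (hsq q k 0 y) by (rewrite <- kern_up; f_equal; lia).
  unfold hsq. simpl. field. apply pow_nonzero; lra.
Qed.

(** * Off-diagonal decay and the limit of large nodes *)

Lemma geometric_bound (q : R) (n : nat) : 0 < q < 1 -> sum_f_R0 (fun i => q ^ i) n <= / (1 - q).
Proof.
  intros Hq. rewrite tech3 by lra.
  assert (0 < q ^ S n) by (apply pow_lt; lra).
  assert (0 < / (1 - q)) by (apply Rinv_0_lt_compat; lra).
  unfold Rdiv. nra.
Qed.

(** Descending induction on j from above k, where the differences vanish: a bounded (j+1)-st
    difference, multiplied by q^y, has geometrically bounded sums. *)
Lemma qdiff_bounded (q : R) (k j : nat) : 0 < q < 1 ->
  exists B, 0 <= B /\ forall y, Rabs (qdiff q (fun n => leg q n k) j y) <= B.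
Proof.
  intros Hq.
  assert (D : forall i j, (k < i + j)%nat ->
    exists B, 0 <= B /\ forall y, Rabs (qdiff q (fun n => leg q n k) j y) <= B).
  { clear j. induction i as [|i IH]; intros j Hj.
    - exists 0. split; [lra|]. intros y. rewrite qdiff_above by (assumption || lia).
      rewrite Rabs_R0. lra.
    - destruct (IH (S j) ltac:(lia)) as [B [HB Hu]].
      set (u := qdiff q (fun n => leg q n k)) in *.
      exists (Rabs (u j 0%nat) + B * / (1 - q)).
      assert (0 < / (1 - q)) by (apply Rinv_0_lt_compat; lra).
      split; [pose proof (Rabs_pos (u j 0%nat)); nra|].
      assert (S0 : forall y, Rabs (u j (S y)) <= Rabs (u j 0%nat) + B * sum_f_R0 (fun i => q ^ i) y).
      { intros y. induction y as [|y IHy].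
        - unfold u at 1. rewrite qdiff_step by lra. fold u. eapply Rle_trans; [apply Rabs_triang|].
          simpl. rewrite Rmult_1_l, Rmult_1_r. specialize (Hu 0%nat). simpl in Hu. lra.
        - unfold u at 1. rewrite qdiff_step by lra. fold u. eapply Rle_trans; [apply Rabs_triang|].
          rewrite Rabs_mult, (Rabs_pos_eq (q ^ S y)) by (apply pow_le; lra).
          rewrite tech5. specialize (Hu (S y)).
          assert (0 < q ^ S y) by (apply pow_lt; lra). nra. }
      intros [|y]; [nra|]. specialize (S0 y). pose proof (geometric_bound q y Hq). nra. }
  apply (D (S k) j). lia.
Qed.

Lemma wgt_bounded (q : R) (k j : nat) : 0 < q < 1 -> (j <= k)%nat ->
  exists B, 0 <= B /\ forall y, wgt q k j y <= B * (q ^ y * q ^ (j * y)).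
Proof.
  intros Hq. induction j as [|j IH]; intros Hj.
  - exists 1. split; [lra|]. intros y. simpl. lra.
  - destruct (IH ltac:(lia)) as [B [HB Hw]]. pose proof (lam_pos q k j Hq Hj) as L.
    assert (0 < / lam q k j) by (apply Rinv_0_lt_compat; lra).
    exists (B * / lam q k j). split; [nra|]. intros y.
    change (wgt q k (S j) y) with (wgt q k j y * (q ^ (y + j) * (1 - q ^ S (y + j)) / lam q k j)).
    pose proof (wgt_nonneg q k j y Hq ltac:(lia)).
    assert (0 < q ^ y) by (apply pow_lt; lra).
    assert (0 < q ^ (j * y)) by (apply pow_lt; lra).
    assert (0 < q ^ S (y + j)) by (apply pow_lt; lra).
    assert (q ^ S (y + j) <= 1) by (apply pow_le_one; lra).
    assert (q ^ j <= 1) by (apply pow_le_one; lra).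
    assert (0 < q ^ j) by (apply pow_lt; lra).
    replace (S j * y)%nat with (y + j * y)%nat by lia.
    rewrite !pow_add. specialize (Hw y).
    apply Rle_trans with (B * (q ^ y * q ^ (j * y)) * (q ^ y * / lam q k j)).
    + apply Rmult_le_compat; [assumption| |assumption|].
      * apply Rlt_le in H; unfold Rdiv. apply Rmult_le_pos; [|assumption].
        apply Rmult_le_pos; [nra | lra].
      * unfold Rdiv. apply Rmult_le_compat_r; [lra|].
        assert (q ^ y * q ^ j <= q ^ y) by nra.
        assert (0 < q ^ y * q ^ j) by nra. nra.
    + right. ring.
Qed.

(** For j >= 1 the weight decays at least like q^(2y), so the kernel is at most a constant times q^y
    q^z; this bound is symmetric and serves both sides of the diagonal. *)
Lemma kern_off_diag (q : R) (k : nat) : 0 < q < 1 ->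
  exists D, 0 <= D /\ forall y z, y <> z -> kern q k y z / q ^ z <= D * q ^ y.
Proof.
  intros Hq.
  assert (P : forall j, exists D, 0 <= D /\ forall y, hsq q k (S j) y <= D * (q ^ (y + S j) * q ^ y)).
  { intros j. destruct (le_lt_dec (S j) k) as [Hj|Hj].
    - destruct (qdiff_bounded q k (S j) Hq) as [B [HB Hu]].
      destruct (wgt_bounded q k (S j) Hq Hj) as [B' [HB' Hw]].
      assert (HJ : 0 < q ^ S j) by (apply pow_lt; lra).
      exists (B' * B ^ 2 / q ^ S j). split.
      { apply Rmult_le_pos; [pose proof (pow2_ge_0 B); nra | apply Rlt_le, Rinv_0_lt_compat, HJ]. }
      intros y. unfold hsq. specialize (Hw y). specialize (Hu y).
      pose proof (wgt_nonneg q k (S j) y Hq Hj).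
      assert (0 < q ^ y) by (apply pow_lt; lra).
      assert (q ^ (j * y) <= 1) by (apply pow_le_one; lra).
      assert (0 < q ^ (j * y)) by (apply pow_lt; lra).
      apply Rle_trans with (B' * (q ^ y * q ^ y) * B ^ 2).
      + apply Rmult_le_compat; [assumption | apply pow2_ge_0 | |].
        * eapply Rle_trans; [exact Hw|]. apply Rmult_le_compat_l; [assumption|].
          replace (S j * y)%nat with (y + j * y)%nat by lia. rewrite pow_add.
          assert (0 < q ^ y * q ^ y) by nra. nra.
        * rewrite <- (pow2_abs (qdiff _ _ _ _)). apply pow_incr. split; [apply Rabs_pos | exact Hu].
      + right. rewrite pow_add. field. lra.
    - exists 0. split; [lra|]. intros y. rewrite hsq_above by assumption. lra. }
  (* Entries with j >= k vanish, so adding finitely many constants gives one uniform in j. *)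
  assert (Q : forall n, exists D, 0 <= D /\ forall j y, (j < n)%nat -> hsq q k (S j) y <= D * (q ^ (y + S j) * q ^ y)).
  { induction n as [|n [D [HD HDn]]].
    - exists 0. split; [lra|]. intros; lia.
    - destruct (P n) as [D' [HD' HDn']]. exists (D + D'). split; [lra|].
      intros j y Hj. assert (0 < q ^ (y + S j) * q ^ y) by (apply Rmult_lt_0_compat; apply pow_lt; lra).
      destruct (Nat.eq_dec j n) as [->|Hne].
      + specialize (HDn' y). nra.
      + specialize (HDn j y ltac:(lia)). nra. }
  destruct (Q k) as [D [HD HDk]].
  assert (A : forall j y, hsq q k (S j) y <= D * (q ^ (y + S j) * q ^ y)).
  { intros j y. destruct (le_lt_dec k j) as [H|H]; [|apply HDk, H].
    rewrite hsq_above by (assumption || lia).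
    apply Rmult_le_pos; [assumption|]. apply Rmult_le_pos; apply pow_le; lra. }
  exists D. split; [assumption|]. intros y z Hyz.
  assert (0 < q ^ z) by (apply pow_lt; lra).
  apply Rle_div_l; [lra|].
  destruct (lt_eq_lt_dec y z) as [[H'|H']|H']; [|lia|].
  - replace (kern q k y z) with (hsq q k (S (z - y - 1)) y) by (rewrite <- kern_up; f_equal; lia).
    eapply Rle_trans; [apply A|]. replace (y + S (z - y - 1))%nat with z by lia. right; ring.
  - rewrite kern_sym.
    replace (kern q k z y) with (hsq q k (S (y - z - 1)) z) by (rewrite <- kern_up; f_equal; lia).
    eapply Rle_trans; [apply A|]. replace (z + S (y - z - 1))%nat with y by lia. right; ring.
Qed.

Lemma qLeg_at_one (q : R) (k : nat) : 0 < q < 1 -> qLeg q k 1 = 1.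
Proof.
  intros Hq.
  assert (E : qLeg q k 1 = 1 /\ qLeg q (S k) 1 = 1).
  { induction k as [|k [IH1 IH2]].
    - unfold qLeg; simpl; unfold Defs.R1, a0, b0. split; [reflexivity|field; lra].
    - split; [assumption|]. pose proof (qLeg_rec q 1 k Hq) as E.
      rewrite IH1, IH2 in E.
      assert (0 < gq q (S (S k))).
      { unfold gq. assert (q ^ S (S k) < 1) by (apply pow_lt_one; [lra | lia]).
        assert (0 < q ^ S (S k)) by (apply pow_lt; lra). apply Rdiv_lt_0_compat; lra. }
      nra. }
  apply E.
Qed.

Lemma qLeg_continuous (q x : R) (k : nat) : continuous (qLeg q k) x.
Proof.
  assert (E : continuous (qLeg q k) x /\ continuous (qLeg q (S k)) x).
  { assert (C1 : continuous (Defs.R1 q) x).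
    { unfold Defs.R1. apply (continuous_ext (fun x => / a0 q * (x - b0 q))).
      - intros z. apply Rmult_comm.
      - apply (continuous_scal_r (/ a0 q) (fun x => x - b0 q)).
        apply (continuous_minus (fun x => x) (fun _ => b0 q));
          [apply continuous_id | apply continuous_const]. }
    induction k as [|k [IH1 IH2]].
    - split; [apply continuous_const | exact C1].
    - split; [assumption|].
      apply (continuous_ext (fun x => / an q (S k) * ((Defs.R1 q x - bn q (S k)) * qLeg q (S k) x - cn q (S k) * qLeg q k x))).
      { intros z. rewrite qLeg_SS. apply Rmult_comm. }
      apply (continuous_scal_r (/ an q (S k))
        (fun x => (Defs.R1 q x - bn q (S k)) * qLeg q (S k) x - cn q (S k) * qLeg q k x)).
      apply (continuous_minus (fun x => (Defs.R1 q x - bn q (S k)) * qLeg q (S k) x)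
        (fun x => cn q (S k) * qLeg q k x)).
      + apply (continuous_mult (fun x => Defs.R1 q x - bn q (S k)) (qLeg q (S k))); [|assumption].
        apply (continuous_minus (Defs.R1 q) (fun _ => bn q (S k))); [assumption | apply continuous_const].
      + apply (continuous_scal_r (cn q (S k)) (qLeg q k)). assumption. }
  apply E.
Qed.

Lemma leg_lim (q : R) (k : nat) : 0 < q < 1 -> is_lim_seq (fun n => leg q n k) 1.
Proof.
  intros Hq. rewrite <- (qLeg_at_one q k Hq). unfold leg.
  apply (is_lim_seq_continuous (qLeg q k) (fun n => 1 - q ^ n) 1).
  - apply continuity_pt_filterlim, qLeg_continuous.
  - replace (Finite 1) with (Finite (1 - 0)) by (f_equal; ring).
    apply is_lim_seq_minus'; [apply is_lim_seq_const|].
    apply is_lim_seq_geom. rewrite Rabs_pos_eq; lra.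
Qed.

(** Write q = r r: n r^n is at most the sum of r, ..., r^n, hence bounded, and the other factor r^n
    tends to 0. *)
Lemma linear_pow_lim (q : R) (c : nat) : 0 < q < 1 ->
  is_lim_seq (fun n => INR (n + c) * q ^ n) 0.
Proof.
  intros Hq. set (r := sqrt q).
  assert (Hr : 0 < r) by (apply sqrt_lt_R0; lra).
  assert (Hr2 : r * r = q) by (apply sqrt_sqrt; lra).
  assert (Hr1 : r < 1) by nra.
  assert (B : forall n, INR n * r ^ n <= / (1 - r)).
  { intros n. apply Rle_trans with (sum_f_R0 (fun i => r ^ i) n); [|apply geometric_bound; lra].
    assert (M : forall m, (m <= n)%nat -> INR m * r ^ n <= sum_f_R0 (fun i => r ^ i) m).
    { induction m as [|m IH]; intros Hm; [simpl; lra|].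
      rewrite S_INR, tech5. specialize (IH ltac:(lia)).
      assert (r ^ n <= r ^ S m); [|lra].
      replace n with (S m + (n - S m))%nat by lia. rewrite pow_add.
      assert (0 < r ^ S m) by (apply pow_lt; lra).
      assert (r ^ (n - S m) <= 1) by (apply pow_le_one; lra). nra. }
    apply M. lia. }
  assert (Hi : 0 < / (1 - r)) by (apply Rinv_0_lt_compat; lra).
  apply (is_lim_seq_le_le (fun _ => 0) _ (fun n => (/ (1 - r) + INR c) * r ^ n)).
  - intros n. assert (E : q ^ n = r ^ n * r ^ n) by (rewrite <- Hr2; apply Rpow_mult_distr).
    assert (0 < r ^ n) by (apply pow_lt; lra).
    assert (r ^ n <= 1) by (apply pow_le_one; lra).
    pose proof (pos_INR n). pose proof (pos_INR c). specialize (B n).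
    rewrite E, plus_INR. split.
    + apply Rmult_le_pos; [lra|nra].
    + rewrite Rmult_plus_distr_r, <- Rmult_assoc, Rmult_plus_distr_r.
      assert (INR c * (r ^ n * r ^ n) <= INR c * r ^ n) by (apply Rmult_le_compat_l; nra).
      nra.
  - apply is_lim_seq_const.
  - replace (Finite 0) with (Finite ((/ (1 - r) + INR c) * 0)) by (f_equal; ring).
    apply is_lim_seq_mult'; [apply is_lim_seq_const|].
    apply is_lim_seq_geom. rewrite Rabs_pos_eq; lra.
Qed.

(** The square is one term of row sum y, which equals row sum m = i + y. The latter is at most its
    diagonal term, tending to 1, plus m + k + 1 times [D * q ^ m], tending to 0. *)
Lemma leg_sq_le_one (q : R) (k y : nat) : 0 < q < 1 -> leg q y k ^ 2 <= 1.
Proof.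
  intros Hq. destruct (kern_off_diag q k Hq) as [D [HD Hoff]].
  assert (B : forall i, leg q y k ^ 2 <= leg q (i + y) k ^ 2 + D * (INR (i + S (y + k)) * (q ^ i * q ^ y))).
  { intros i. set (m := (i + y)%nat). set (N := (m + k)%nat).
    assert (P : forall x s, 0 <= kern q k x s / q ^ s).
    { intros x s. apply Rmult_le_pos; [apply kern_nonneg, Hq|].
      apply Rlt_le, Rinv_0_lt_compat, pow_lt; lra. }
    apply Rle_trans with (rowsum q k N y).
    { rewrite <- kern_diag by lra. unfold rowsum.
      apply (sum_ge_term (fun s => kern q k y s / q ^ s)); [apply P | unfold N, m; lia]. }
    rewrite (rowsum_const q k N y m) by (assumption || (unfold N, m; lia)).
    apply Rle_trans with (sum_f_R0 (fun s => (if Nat.eq_dec s m then leg q m k ^ 2 else 0) + D * q ^ m) N).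
    - apply sum_Rle. intros s _. destruct (Nat.eq_dec s m) as [->|Hne].
      + rewrite kern_diag by lra. assert (0 < q ^ m) by (apply pow_lt; lra).
        pose proof (Rmult_le_pos D (q ^ m) HD ltac:(lra)). lra.
      + rewrite Rplus_0_l. apply Hoff. lia.
    - rewrite plus_sum, sum_cte.
      assert (Z : forall M, sum_f_R0 (fun s => if Nat.eq_dec s m then leg q m k ^ 2 else 0) M <= leg q m k ^ 2 /\
         ((M < m)%nat -> sum_f_R0 (fun s => if Nat.eq_dec s m then leg q m k ^ 2 else 0) M = 0)).
      { pose proof (pow2_ge_0 (leg q m k)) as Hp.
        induction M as [|M [IH1 IH2]].
        - unfold sum_f_R0. destruct (Nat.eq_dec 0 m); (split; [apply Rle_refl || exact Hp | intros; (reflexivity || lia)]).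
        - rewrite tech5. destruct (Nat.eq_dec (S M) m) as [e|e].
          + rewrite IH2 by lia. split; [lra|lia].
          + split; [lra|]. intros; rewrite IH2 by lia; ring. }
      apply Rplus_le_compat; [apply Z|].
      right. unfold N, m. rewrite pow_add. replace (S (i + y + k)) with (i + S (y + k))%nat by lia. ring. }
  apply (is_lim_seq_le (fun _ => leg q y k ^ 2) _ (leg q y k ^ 2) 1 B).
  - apply is_lim_seq_const.
  - replace (Finite 1) with (Finite (1 ^ 2 + D * (q ^ y) * 0)) by (f_equal; ring).
    apply is_lim_seq_plus'.
    + apply (is_lim_seq_ext (fun i => leg q (i + y) k * leg q (i + y) k)); [intros; ring|].
      replace (Finite (1 ^ 2)) with (Finite (1 * 1)) by (f_equal; ring).
      assert (is_lim_seq (fun i => leg q (i + y) k) 1).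
      { apply -> (is_lim_seq_incr_n (fun n => leg q n k) y). apply leg_lim, Hq. }
      apply is_lim_seq_mult'; assumption.
    + apply (is_lim_seq_ext (fun i => D * q ^ y * (INR (i + S (y + k)) * q ^ i))); [intros; ring|].
      apply is_lim_seq_mult'; [apply is_lim_seq_const | apply linear_pow_lim, Hq].
Qed.

Lemma leg_abs_le_one (q : R) (n k : nat) : 0 < q < 1 -> Rabs (leg q n k) <= 1.
Proof.
  intros Hq. pose proof (leg_sq_le_one q k n Hq) as E.
  rewrite <- pow2_abs in E. pose proof (Rabs_pos (leg q n k)). nra.
Qed.

(** * Decay in the degree and the l^2 norm *)

Lemma lam_zero_bound (q : R) (k : nat) : 0 < q < 1 -> Rabs (lam q k 0) <= / q ^ k.
Proof.
  intros Hq. unfold lam.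
  assert (HP : 0 < q ^ k) by (apply pow_lt; lra).
  assert (HP1 : q ^ k <= 1) by (apply pow_le_one; lra).
  assert (HS : 0 < q ^ (k + 0 + 1)) by (apply pow_lt; lra).
  assert (HS1 : q ^ (k + 0 + 1) <= 1) by (apply pow_le_one; lra).
  assert (0 < / q ^ k) by (apply Rinv_0_lt_compat; lra).
  replace ((q ^ 0 - q ^ k) / q ^ k * (1 - q ^ (k + 0 + 1)))
    with (/ q ^ k * ((1 - q ^ k) * (1 - q ^ (k + 0 + 1)))) by (simpl; field; lra).
  rewrite Rabs_pos_eq; [|apply Rmult_le_pos; [lra|apply Rmult_le_pos; lra]].
  rewrite <- (Rmult_1_r (/ q ^ k)) at 2. apply Rmult_le_compat_l; [lra|nra].
Qed.

(** For k <= r the right side is at least 1; beyond r each step multiplies the left side by at most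
    q^r. *)
Lemma leg_zero_decay (q : R) (r k : nat) : 0 < q < 1 ->
  Rabs (leg q 0 k) <= / q ^ (r * r) * q ^ (r * k).
Proof.
  intros Hq.
  assert (HR : 0 < / q ^ (r * r)) by (apply Rinv_0_lt_compat, pow_lt; lra).
  assert (Low : forall k, (k <= r)%nat -> Rabs (leg q 0 k) <= / q ^ (r * r) * q ^ (r * k)).
  { clear k. intros k Hk. apply Rle_trans with 1; [apply leg_abs_le_one, Hq|].
    replace (r * r)%nat with (r * k + r * (r - k))%nat by nia. rewrite pow_add.
    assert (0 < q ^ (r * k)) by (apply pow_lt; lra).
    assert (0 < q ^ (r * (r - k))) by (apply pow_lt; lra).
    assert (q ^ (r * (r - k)) <= 1) by (apply pow_le_one; lra).
    replace (/ (q ^ (r * k) * q ^ (r * (r - k))) * q ^ (r * k)) with (/ q ^ (r * (r - k)))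
      by (field; split; lra).
    rewrite <- Rinv_1. apply Rinv_le_contravar; lra. }
  induction k as [|k IH]; [apply Low; lia|].
  destruct (le_lt_dec (S k) r) as [H|H]; [apply Low, H|].
  rewrite leg_at_zero, Rabs_mult, Rabs_Ropp, Rabs_pos_eq by (assumption || (apply pow_le; lra)).
  replace (r * S k)%nat with (r + r * k)%nat by lia. rewrite pow_add.
  replace (S k) with (r + (S k - r))%nat by lia. rewrite pow_add.
  assert (0 < q ^ r) by (apply pow_lt; lra).
  assert (0 < q ^ (S k - r)) by (apply pow_lt; lra).
  assert (q ^ (S k - r) <= 1) by (apply pow_le_one; lra).
  pose proof (Rabs_pos (leg q 0 k)).
  apply Rle_trans with (q ^ r * Rabs (leg q 0 k)); [|nra].
  apply Rmult_le_compat_r; [assumption|nra].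
Qed.

Lemma leg_decay (q : R) (n r : nat) : 0 < q < 1 ->
  exists C, 0 <= C /\ forall k, Rabs (leg q n k) <= C * q ^ (r * k).
Proof.
  intros Hq. revert r.
  (* The equation in n has order two, so [pred n] is carried along; all r are treated at once
     because [lam q k 0], of size up to q^(-k), costs one order of decay. *)
  assert (H : forall n,
    (forall r, exists C, 0 <= C /\ forall k, Rabs (leg q n k) <= C * q ^ (r * k)) /\
    (forall r, exists C, 0 <= C /\ forall k, Rabs (leg q (pred n) k) <= C * q ^ (r * k)));
    [|apply H].
  clear n. induction n as [|n [IH1 IH2]].
  - assert (B : forall r, exists C, 0 <= C /\ forall k, Rabs (leg q 0 k) <= C * q ^ (r * k)).
    { intros r. exists (/ q ^ (r * r)). split.
      - apply Rlt_le, Rinv_0_lt_compat, pow_lt; lra.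
      - intros k. apply leg_zero_decay, Hq. }
    split; exact B.
  - split; [|exact IH1]. intros r.
    destruct (IH1 (S r)) as [C1 [HC1 H1]]. destruct (IH2 r) as [C2 [HC2 H2]].
    assert (Hi : 0 < / (1 - q)) by (apply Rinv_0_lt_compat; lra).
    (* In the bracket C1 + C2 bounds the difference and the last C1 the eigenvalue term; [/ (1 - q)]
       bounds [/ (1 - q ^ S n)]. *)
    exists (C1 + / (1 - q) * (C1 + C2 + C1)). split; [nra|]. intros k.
    assert (HS : q ^ S n <= q).
    { simpl. pose proof (pow_le_one q n Hq). nra. }
    assert (E : leg q (S n) k = leg q n k + / (1 - q ^ S n) *
       ((1 - q ^ n) * (leg q n k - leg q (pred n) k) + - lam q k 0 * q ^ n * leg q n k)).
    { rewrite <- leg_diff_eq by assumption. field. lra. }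
    rewrite E. clear E. specialize (H1 k). specialize (H2 k).
    pose proof (lam_zero_bound q k Hq) as HL.
    set (f := leg q n k) in *. set (g := leg q (pred n) k) in *. set (l := lam q k 0) in *.
    assert (HP : 0 < q ^ k) by (apply pow_lt; lra).
    assert (HP1 : q ^ k <= 1) by (apply pow_le_one; lra).
    assert (HN : 0 < q ^ n) by (apply pow_lt; lra).
    assert (HN1 : q ^ n <= 1) by (apply pow_le_one; lra).
    assert (HR : 0 < q ^ (r * k)) by (apply pow_lt; lra).
    replace (S r * k)%nat with (k + r * k)%nat in H1 by lia. rewrite pow_add in H1.
    set (Y := q ^ (r * k)) in *.
    assert (Hf : Rabs f <= C1 * Y).
    { eapply Rle_trans; [exact H1|]. apply Rmult_le_compat_l; [assumption|nra]. }
    assert (Hlf : Rabs (- l * q ^ n * f) <= C1 * Y).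
    { rewrite !Rabs_mult, Rabs_Ropp, (Rabs_pos_eq (q ^ n)) by lra.
      pose proof (Rabs_pos f). pose proof (Rabs_pos l).
      apply Rle_trans with (/ q ^ k * (C1 * (q ^ k * Y))).
      - apply Rmult_le_compat; [nra|lra| |assumption]. nra.
      - right. field. lra. }
    assert (Hfg : Rabs ((1 - q ^ n) * (f - g)) <= C1 * Y + C2 * Y).
    { rewrite Rabs_mult, (Rabs_pos_eq (1 - q ^ n)) by lra.
      pose proof (Rabs_triang f (- g)) as T. rewrite Rabs_Ropp in T. unfold Rminus at 2.
      pose proof (Rabs_pos (f + - g)). nra. }
    assert (Hn : 0 < / (1 - q ^ S n) <= / (1 - q)).
    { split; [apply Rinv_0_lt_compat; lra | apply Rinv_le_contravar; lra]. }
    eapply Rle_trans; [apply Rabs_triang|].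
    rewrite Rabs_mult, (Rabs_pos_eq (/ (1 - q ^ S n))) by lra.
    pose proof (Rabs_triang ((1 - q ^ n) * (f - g)) (- l * q ^ n * f)) as T.
    set (X := Rabs ((1 - q ^ n) * (f - g) + - l * q ^ n * f)) in *.
    assert (0 <= X) by apply Rabs_pos.
    assert (/ (1 - q ^ S n) * X <= / (1 - q) * (C1 * Y + C2 * Y + C1 * Y)).
    { apply Rmult_le_compat; lra. }
    lra.
Qed.

(** * Haar weights and convergence of the series *)

Lemma hw_bounds (q : R) (k : nat) : 0 < q < 1 -> 0 < hw q k < / q ^ k * / (1 - q).
Proof.
  intros Hq. unfold hw.
  assert (0 < / q ^ k) by (apply Rinv_0_lt_compat, pow_lt; lra).
  assert (0 < / (1 - q)) by (apply Rinv_0_lt_compat; lra).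
  assert (q ^ (2 * k + 1) < 1) by (apply pow_lt_one; [lra | lia]).
  assert (0 < q ^ (2 * k + 1)) by (apply pow_lt; lra).
  unfold Rdiv. split.
  - apply Rmult_lt_0_compat; [assumption|]. apply Rmult_lt_0_compat; lra.
  - apply Rmult_lt_compat_l; [assumption|]. nra.
Qed.

Lemma ex_series_geom_bound (q C : R) (a : nat -> R) : 0 < q < 1 ->
  (forall k, Rabs (a k) <= C * q ^ k) -> ex_series a.
Proof.
  intros Hq Ha. apply (ex_series_le a (fun k => C * q ^ k)); [exact Ha|].
  apply (ex_series_scal_l C (fun k => q ^ k)). apply ex_series_geom. rewrite Rabs_pos_eq; lra.
Qed.

Lemma ex_series_leg1 (q : R) (n : nat) : 0 < q < 1 ->
  ex_series (fun k => Rabs (leg q n k) * hw q k).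
Proof.
  (* Order 2: one factor q^k offsets the growth of [hw], the other makes the bound geometric. *)
  intros Hq. destruct (leg_decay q n 2 Hq) as [C [HC HB]].
  apply (ex_series_geom_bound q (C * / (1 - q))); [assumption|].
  intros k. destruct (hw_bounds q k Hq) as [H1 H2]. specialize (HB k).
  rewrite Rabs_pos_eq; [|apply Rmult_le_pos; [apply Rabs_pos|lra]].
  assert (0 < q ^ k) by (apply pow_lt; lra).
  replace (C * / (1 - q) * q ^ k) with (C * q ^ (2 * k) * (/ q ^ k * / (1 - q))).
  - apply Rmult_le_compat; [apply Rabs_pos|lra|assumption|lra].
  - replace (2 * k)%nat with (k + k)%nat by lia. rewrite pow_add. field. lra.
Qed.

Lemma ex_series_leg2 (q : R) (n m : nat) : 0 < q < 1 ->
  ex_series (fun k => hw q k * (leg q n k * leg q m k)).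
Proof.
  intros Hq. apply (@ex_series_le R_AbsRing R_CompleteNormedModule _ (fun k => Rabs (leg q n k) * hw q k)); [|apply ex_series_leg1, Hq].
  intros k. change (Rabs (hw q k * (leg q n k * leg q m k)) <= Rabs (leg q n k) * hw q k).
  rewrite !Rabs_mult.
  destruct (hw_bounds q k Hq) as [H1 _]. rewrite (Rabs_pos_eq (hw q k)) by lra.
  pose proof (leg_abs_le_one q m k Hq). pose proof (Rabs_pos (leg q n k)).
  pose proof (Rabs_pos (leg q m k)).
  rewrite (Rmult_comm (Rabs (leg q n k)) (hw q k)). apply Rmult_le_compat_l; [lra|nra].
Qed.

Lemma leg_lim_k (q : R) (n : nat) : 0 < q < 1 -> is_lim_seq (leg q n) 0.
Proof.
  intros Hq. destruct (leg_decay q n 1 Hq) as [C [HC HB]].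
  apply is_lim_seq_abs_0.
  apply (is_lim_seq_le_le (fun _ => 0) _ (fun k => C * q ^ k)).
  - intros k. specialize (HB k). rewrite Nat.mul_1_l in HB. split; [apply Rabs_pos|assumption].
  - apply is_lim_seq_const.
  - replace (Finite 0) with (Finite (C * 0)) by (f_equal; ring).
    apply is_lim_seq_mult'; [apply is_lim_seq_const|].
    apply is_lim_seq_geom. rewrite Rabs_pos_eq; lra.
Qed.

(** * Orthogonality and the l^2 norm *)

Lemma gq_bounds (q : R) (m : nat) : 0 < q < 1 -> 0 < gq q (S m) < 1.
Proof.
  intros Hq. unfold gq.
  assert (q ^ S m < 1) by (apply pow_lt_one; [lra | lia]).
  assert (0 < q ^ S m) by (apply pow_lt; lra). split.
  - apply Rdiv_lt_0_compat; lra.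
  - apply Rlt_div_l; lra.
Qed.

Lemma hw_one_minus (q : R) (k : nat) : 0 < q < 1 -> (1 - q) * hw q k = / q ^ k - q ^ S k.
Proof.
  intros Hq. unfold hw. assert (0 < q ^ k) by (apply pow_lt; lra).
  replace (2 * k + 1)%nat with (k + S k)%nat by lia. rewrite pow_add. field. lra.
Qed.

(** The Christoffel-Darboux formula: the divergence forms at two nodes are multiplied crosswise and
    subtracted, and the Wronskians telescope. *)
Lemma leg_wronskian (q : R) (n m N : nat) : 0 < q < 1 ->
  (q ^ n - q ^ m) * (1 - q) * sum_f_R0 (fun k => hw q k * (leg q n k * leg q m k)) N =
  - gq q (S N) * (leg q n (S N) * leg q m N - leg q m (S N) * leg q n N).
Proof.
  intros Hq. induction N as [|N IH].
  - pose proof (leg_rec0 q n Hq) as E1. pose proof (leg_rec0 q m Hq) as E2.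
    simpl sum_f_R0. replace (hw q 0) with 1 by (unfold hw; simpl; field; lra).
    transitivity (- (gq q 1 * (leg q n 1 - leg q n 0) * leg q m 0 - gq q 1 * (leg q m 1 - leg q m 0) * leg q n 0)).
    + rewrite E1, E2. ring.
    + ring.
  - pose proof (leg_rec q n N Hq) as E1. pose proof (leg_rec q m N Hq) as E2.
    rewrite tech5, Rmult_plus_distr_l, IH.
    replace ((q ^ n - q ^ m) * (1 - q) * (hw q (S N) * (leg q n (S N) * leg q m (S N))))
      with ((q ^ n - q ^ m) * ((1 - q) * hw q (S N)) * (leg q n (S N) * leg q m (S N))) by ring.
    rewrite hw_one_minus by assumption.
    transitivity (- (gq q (S (S N)) * (leg q n (S (S N)) - leg q n (S N)) * leg q m (S N)
      - gq q (S (S N)) * (leg q m (S (S N)) - leg q m (S N)) * leg q n (S N))); [|ring].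
    rewrite E1, E2. ring.
Qed.

Definition inner (q : R) (n m : nat) : R := Series (fun k => hw q k * (leg q n k * leg q m k)).

Lemma is_series_sum_f_R0 (a : nat -> R) (l : R) :
  is_lim_seq (sum_f_R0 a) l -> is_series a l.
Proof.
  intros H. apply (is_lim_seq_ext (sum_f_R0 a) (sum_n a)) in H; [exact H|].
  intros n. rewrite sum_n_Reals. reflexivity.
Qed.

Lemma inner_neq (q : R) (n m : nat) : 0 < q < 1 -> n <> m -> inner q n m = 0.
Proof.
  intros Hq Hnm. apply is_series_unique, is_series_sum_f_R0.
  assert (Hd : q ^ n - q ^ m <> 0).
  { assert (L : forall a b, (a < b)%nat -> q ^ b < q ^ a).
    { intros a b Hab. replace b with (a + (b - a))%nat by lia. rewrite pow_add.
      assert (0 < q ^ a) by (apply pow_lt; lra).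
      assert (q ^ (b - a) < 1) by (apply pow_lt_one; [lra | lia]). nra. }
    destruct (lt_eq_lt_dec n m) as [[H|H]|H]; [apply L in H; lra|lia|apply L in H; lra]. }
  set (c := (q ^ n - q ^ m) * (1 - q)).
  assert (Hc : c <> 0) by (unfold c; apply Rmult_integral_contrapositive_currified; [assumption|lra]).
  apply (is_lim_seq_ext (fun N => / c * (- gq q (S N) * (leg q n (S N) * leg q m N - leg q m (S N) * leg q n N)))).
  { intros N. rewrite <- leg_wronskian by assumption. fold c. field. assumption. }
  replace (Finite 0) with (Finite (/ c * 0)) by (f_equal; ring).
  apply is_lim_seq_mult'; [apply is_lim_seq_const|].
  apply is_lim_seq_abs_0.
  apply (is_lim_seq_le_le (fun _ => 0) _ (fun N => Rabs (leg q m N) + Rabs (leg q n N))).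
  - intros N. split; [apply Rabs_pos|].
    destruct (gq_bounds q N Hq).
    rewrite Rabs_mult, Rabs_Ropp, (Rabs_pos_eq (gq q (S N))) by lra.
    pose proof (Rabs_triang (leg q n (S N) * leg q m N) (- (leg q m (S N) * leg q n N))) as T.
    rewrite Rabs_Ropp, !Rabs_mult in T. unfold Rminus.
    pose proof (leg_abs_le_one q n (S N) Hq). pose proof (leg_abs_le_one q m (S N) Hq).
    pose proof (Rabs_pos (leg q m N)). pose proof (Rabs_pos (leg q n N)).
    pose proof (Rabs_pos (leg q n (S N) * leg q m N + - (leg q m (S N) * leg q n N))). nra.
  - apply is_lim_seq_const.
  - replace (Finite 0) with (Finite (0 + 0)) by (f_equal; ring).
    apply is_lim_seq_plus'; apply (is_lim_seq_abs_0 (leg q _)), leg_lim_k, Hq.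
Qed.

Lemma inner_zero (q : R) : 0 < q < 1 -> inner q 0 0 = / (1 - q).
Proof.
  intros Hq. apply is_series_unique, is_series_sum_f_R0.
  (* The first-order recurrence turns q^(-k) R_k(0)^2 into q^k R_(k-1)(0)^2, so the partial sums
     telescope to this closed form. *)
  apply (is_lim_seq_ext (fun N => / (1 - q) * (1 - q ^ S N * leg q 0 N * leg q 0 N))).
  { intros N. induction N as [|N IH].
    - simpl. unfold hw, leg, qLeg. simpl. field. lra.
    - rewrite tech5, <- IH. rewrite leg_at_zero by assumption.
      replace (hw q (S N)) with (/ (1 - q) * ((1 - q) * hw q (S N))) by (field; lra).
      rewrite hw_one_minus by assumption.
      assert (0 < q ^ S N) by (apply pow_lt; lra). field. lra. }
  replace (Finite (/ (1 - q))) with (Finite (/ (1 - q) * (1 - 0 * 0 * 0))) by (f_equal; ring).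
  apply is_lim_seq_mult'; [apply is_lim_seq_const|].
  apply is_lim_seq_minus'; [apply is_lim_seq_const|].
  repeat apply is_lim_seq_mult'; try apply leg_lim_k, Hq.
  apply (is_lim_seq_incr_1 (fun n => q ^ n)). apply is_lim_seq_geom. rewrite Rabs_pos_eq; lra.
Qed.

Lemma inner_diff_eq (q : R) (n m : nat) : 0 < q < 1 ->
  (1 - q ^ S n) * (inner q (S n) m - inner q n m) - (1 - q ^ n) * (inner q n m - inner q (pred n) m) =
  - q ^ n * Series (fun k => lam q k 0 * (hw q k * (leg q n k * leg q m k))).
Proof.
  intros Hq. unfold inner.
  rewrite <- !Series_minus by (apply ex_series_leg2, Hq).
  rewrite <- !Series_scal_l.
  rewrite <- Series_minus.
  - apply Series_ext. intros k. pose proof (leg_diff_eq q k n Hq) as E.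
    transitivity (hw q k * leg q m k * ((1 - q ^ S n) * (leg q (S n) k - leg q n k)
      - (1 - q ^ n) * (leg q n k - leg q (pred n) k))); [ring|].
    rewrite E. ring.
  - apply (ex_series_scal_l (K := R_AbsRing) (V := R_NormedModule) (1 - q ^ S n)), (ex_series_minus (K := R_AbsRing) (V := R_NormedModule)); apply ex_series_leg2, Hq.
  - apply (ex_series_scal_l (K := R_AbsRing) (V := R_NormedModule) (1 - q ^ n)), (ex_series_minus (K := R_AbsRing) (V := R_NormedModule)); apply ex_series_leg2, Hq.
Qed.

(** The equation at n paired with f_(n+1) and the one at n+1 paired with f_n contain the same sum
    [s]; orthogonality leaves one squared norm in each, and eliminating [s] gives the factor 1/q. *)
Lemma inner_self (q : R) (n : nat) : 0 < q < 1 -> inner q n n = / q ^ n * / (1 - q).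
Proof.
  intros Hq. induction n as [|n IH].
  - rewrite inner_zero by assumption. simpl. field. lra.
  - pose proof (inner_diff_eq q n (S n) Hq) as E1.
    pose proof (inner_diff_eq q (S n) n Hq) as E2. simpl pred in E2.
    rewrite (inner_neq q n (S n)), (inner_neq q (pred n) (S n)) in E1 by (assumption || lia).
    rewrite (inner_neq q (S (S n)) n), (inner_neq q (S n) n) in E2 by (assumption || lia).
    rewrite (Series_ext _ (fun k => lam q k 0 * (hw q k * (leg q n k * leg q (S n) k)))) in E2
      by (intros k; ring).
    set (s := Series _) in *. rewrite IH in E2.
    assert (HN : 0 < q ^ n) by (apply pow_lt; lra).
    assert (HS : q ^ S n < 1) by (apply pow_lt_one; [lra | lia]).
    apply Rmult_eq_reg_l with (q * (1 - q ^ S n)); [|apply Rmult_integral_contrapositive_currified; lra].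
    transitivity (q * ((1 - q ^ S n) * (inner q (S n) (S n) - 0) - (1 - q ^ n) * (0 - 0))); [ring|].
    rewrite E1.
    transitivity (- q ^ S n * s); [simpl; ring|]. rewrite <- E2. simpl. field. lra.
Qed.

(** * The tail of the l^1 norm *)

(** The condition on K makes q^n / q^(m+1) at least 4 from m = n + K on; the bounds on [gq] come
    from (1 - t)/(1 + t) <= 1 - t. *)
Lemma tail_coef (q : R) (n m K : nat) : 0 < q < 1 -> 4 * q ^ S K <= 1 -> (n + K <= m)%nat ->
  4 <= q ^ n * / q ^ S m /\
  2 * (gq q (S m) + gq q (S (S m))) <= q ^ n * / q ^ S m * (1 - q ^ S m * q ^ S (S m)) /\
  2 * (gq q (S m) + gq q (S (S m))) <= 4 * (1 - q ^ S m * q ^ S (S m)).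
Proof.
  intros Hq HK Hm.
  assert (Hn : 0 < q ^ n) by (apply pow_lt; lra).
  assert (HM : 0 < q ^ S m) by (apply pow_lt; lra).
  assert (HM1 : q ^ S m < 1) by (apply pow_lt_one; [lra | lia]).
  assert (HX : 4 <= q ^ n * / q ^ S m).
  { apply (Rmult_le_reg_r (q ^ S m)); [assumption|].
    rewrite Rmult_assoc, Rinv_l, Rmult_1_r by lra.
    replace (S m) with (n + (S K + (m - n - K)))%nat by lia. rewrite !pow_add.
    assert (0 < q ^ S K) by (apply pow_lt; lra).
    assert (0 < q ^ (m - n - K)) by (apply pow_lt; lra).
    assert (q ^ (m - n - K) <= 1) by (apply pow_le_one; lra).
    replace (4 * (q ^ n * (q ^ S K * q ^ (m - n - K)))) with (q ^ n * (4 * q ^ S K * q ^ (m - n - K))) by ring.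
    rewrite <- (Rmult_1_r (q ^ n)) at 2. apply Rmult_le_compat_l; nra. }
  assert (HP : q ^ S (S m) = q * q ^ S m) by reflexivity.
  assert (H4 : 2 * (gq q (S m) + gq q (S (S m))) <= 4 * (1 - q ^ S m * q ^ S (S m))).
  { assert (G : forall t, 0 < t < 1 -> (1 - t) / (1 + t) <= 1 - t).
    { intros t Ht. apply Rle_div_l; nra. }
    unfold gq. rewrite HP. set (t := q ^ S m) in *.
    assert (0 < q * t < 1) by nra.
    pose proof (G t ltac:(lra)). pose proof (G (q * t) ltac:(lra)).
    assert (t * (q * t) <= t) by nra. assert (t * (q * t) <= q * t) by nra. lra. }
  split; [assumption|]. split; [|assumption].
  eapply Rle_trans; [exact H4|]. apply Rmult_le_compat_r; [nra|assumption].
Qed.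

Lemma leg_rec_tail (q : R) (n m : nat) : 0 < q < 1 ->
  gq q (S (S m)) * leg q n (S (S m)) + gq q (S m) * leg q n m =
  - (q ^ n * / q ^ S m * (1 - q ^ S m * q ^ S (S m)) - gq q (S m) - gq q (S (S m))) * leg q n (S m).
Proof.
  intros Hq. pose proof (leg_rec q n m Hq) as E.
  assert (0 < q ^ S m) by (apply pow_lt; lra).
  replace (q ^ n * / q ^ S m * (1 - q ^ S m * q ^ S (S m))) with (q ^ n * (/ q ^ S m - q ^ S (S m))) by (field; lra).
  lra.
Qed.

(* If the absolute value increased once in the tail, the recurrence would make it increase forever, contradicting the decay. *)
Lemma leg_tail_antitone (q : R) (n m K : nat) : 0 < q < 1 -> 4 * q ^ S K <= 1 -> (n + K <= m)%nat ->
  Rabs (leg q n (S m)) <= Rabs (leg q n m).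
Proof.
  intros Hq HK Hm. apply Rnot_lt_le. intros Hlt.
  assert (Up : forall i, Rabs (leg q n (i + m)) <= Rabs (leg q n (S (i + m)))).
  { induction i as [|i IH]; [simpl; lra|]. change (S i + m)%nat with (S (i + m)).
    destruct (tail_coef q n (i + m) K Hq HK ltac:(lia)) as [_ [H2 _]].
    pose proof (leg_rec_tail q n (i + m) Hq) as E.
    destruct (gq_bounds q (i + m) Hq) as [Hg _]. destruct (gq_bounds q (S (i + m)) Hq) as [Hg' _].
    set (g := gq q (S (i + m))) in *. set (g' := gq q (S (S (i + m)))) in *.
    set (X := q ^ n * / q ^ S (i + m) * (1 - q ^ S (i + m) * q ^ S (S (i + m)))) in *.
    assert (T : (X - g - g') * Rabs (leg q n (S (i + m))) <=
       g' * Rabs (leg q n (S (S (i + m)))) + g * Rabs (leg q n (i + m))).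
    { rewrite <- (Rabs_pos_eq (X - g - g')) at 1 by lra.
      rewrite <- (Rabs_Ropp (X - g - g')), <- Rabs_mult, <- E.
      eapply Rle_trans; [apply Rabs_triang|]. rewrite !Rabs_mult, (Rabs_pos_eq g'), (Rabs_pos_eq g) by lra. lra. }
    pose proof (Rmult_le_compat_l g _ _ (Rlt_le _ _ Hg) IH).
    assert ((g + g') * Rabs (leg q n (S (i + m))) <= (X - g - g') * Rabs (leg q n (S (i + m))))
      by (apply Rmult_le_compat_r; [apply Rabs_pos | lra]).
    apply (Rmult_le_reg_l g'); lra. }
  assert (Low : forall i, Rabs (leg q n (S m)) <= Rabs (leg q n (i + S m))).
  { induction i as [|i IH]; [simpl; lra|]. eapply Rle_trans; [exact IH|].
    replace (S i + S m)%nat with (S (S i + m)) by lia.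
    replace (i + S m)%nat with (S i + m)%nat by lia. apply (Up (S i)). }
  assert (L : is_lim_seq (fun i => Rabs (leg q n (i + S m))) 0).
  { apply (is_lim_seq_abs_0 (fun i => leg q n (i + S m))).
    apply -> (is_lim_seq_incr_n (leg q n) (S m)). apply leg_lim_k, Hq. }
  pose proof (is_lim_seq_le _ _ _ _ Low (is_lim_seq_const _) L) as C. simpl in C.
  pose proof (Rabs_pos (leg q n m)). lra.
Qed.

(** Monotonicity one step further absorbs the value at degree m + 2 into the one at m + 1, leaving a
    two-term inequality. *)
Lemma leg_tail_ratio (q : R) (n m K : nat) : 0 < q < 1 -> 4 * q ^ S K <= 1 -> (n + K <= m)%nat ->
  Rabs (leg q n (S m)) <= 4 * (q ^ S m / q ^ n) * Rabs (leg q n m).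
Proof.
  intros Hq HK Hm.
  destruct (tail_coef q n m K Hq HK Hm) as [H1 [H2 H3]].
  pose proof (leg_tail_antitone q n (S m) K Hq HK ltac:(lia)) as A.
  pose proof (leg_rec_tail q n m Hq) as E.
  destruct (gq_bounds q m Hq) as [Hg _]. destruct (gq_bounds q (S m) Hq) as [Hg' _].
  assert (Hn : 0 < q ^ n) by (apply pow_lt; lra).
  assert (HM : 0 < q ^ S m) by (apply pow_lt; lra).
  set (X := q ^ n * / q ^ S m) in *.
  replace (q ^ S m / q ^ n) with (/ X) by (unfold X; field; lra).
  set (s := 1 - q ^ S m * q ^ S (S m)) in *.
  set (g := gq q (S m)) in *. set (g' := gq q (S (S m))) in *.
  (* The source of the factor 4: since s >= (g + g')/2 and X >= 4, the right side exceeds the left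
     by at least (X/4 - 1)(g + 2 g'). *)
  assert (B : g * X / 4 <= X * s - g - 2 * g') by nra.
  assert (T : (X * s - g - g') * Rabs (leg q n (S m)) <=
     g' * Rabs (leg q n (S (S m))) + g * Rabs (leg q n m)).
  { rewrite <- (Rabs_pos_eq (X * s - g - g')) by lra.
    rewrite <- (Rabs_Ropp (X * s - g - g')), <- Rabs_mult, <- E.
    eapply Rle_trans; [apply Rabs_triang|]. rewrite !Rabs_mult, (Rabs_pos_eq g'), (Rabs_pos_eq g) by lra. lra. }
  pose proof (Rabs_pos (leg q n (S m))).
  assert (g * (X / 4 * Rabs (leg q n (S m))) <= g * Rabs (leg q n m)) by nra.
  apply Rmult_le_reg_l in H0; [|assumption].
  apply (Rmult_le_reg_l (X / 4)); [lra|].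
  replace (X / 4 * (4 * / X * Rabs (leg q n m))) with (Rabs (leg q n m)) by (field; lra).
  assumption.
Qed.

(** This is 4^k q^((2K+k-1)k/2), the term of the series in [Cq]; the product form keeps the
    exponents natural numbers. *)
Fixpoint tail_weight (q : R) (K k : nat) : R :=
  match k with
  | O => 1
  | S k' => tail_weight q K k' * (4 * q ^ (K + k'))
  end.

Lemma tail_weight_pos (q : R) (K k : nat) : 0 < q < 1 -> 0 < tail_weight q K k.
Proof.
  intros Hq. induction k as [|k IH]; simpl; [lra|].
  assert (0 < q ^ (K + k)) by (apply pow_lt; lra). apply Rmult_lt_0_compat; lra.
Qed.

Lemma tail_weight_Rpower (q : R) (K k : nat) : 0 < q < 1 ->
  4 ^ k * Rpower q ((2 * INR K + INR k - 1) * INR k / 2) = tail_weight q K k.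
Proof.
  intros Hq. induction k as [|k IH].
  - simpl. replace ((2 * INR K + 0 - 1) * 0 / 2) with 0 by field. rewrite Rpower_O by lra. ring.
  - simpl tail_weight. rewrite <- IH, <- (Rpower_pow (K + k)) by lra.
    transitivity (4 ^ S k * (Rpower q ((2 * INR K + INR k - 1) * INR k / 2) * Rpower q (INR (K + k)))).
    + rewrite <- Rpower_plus. f_equal. f_equal. rewrite S_INR, plus_INR. field.
    + simpl. ring.
Qed.

Lemma ex_series_tail_weight (q : R) (K : nat) : 0 < q < 1 ->
  ex_series (fun m => tail_weight q K (S m)).
Proof.
  intros Hq. apply (ex_series_ext (fun m => Rabs (tail_weight q K (S m)))).
  { intros m. apply Rabs_pos_eq, Rlt_le, tail_weight_pos, Hq. }
  apply (ex_series_DAlembert _ 0); [lra| |].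
  - intros m. pose proof (tail_weight_pos q K (S m) Hq). lra.
  - apply (is_lim_seq_ext (fun m => 4 * q ^ K * q ^ S m)).
    + intros m. change (tail_weight q K (S (S m))) with (tail_weight q K (S m) * (4 * q ^ (K + S m))).
      pose proof (tail_weight_pos q K (S m) Hq).
      replace (tail_weight q K (S m) * (4 * q ^ (K + S m)) / tail_weight q K (S m))
        with (4 * q ^ (K + S m)) by (field; lra).
      assert (0 < q ^ (K + S m)) by (apply pow_lt; lra).
      rewrite Rabs_pos_eq, pow_add by lra. ring.
    + replace (Finite 0) with (Finite (4 * q ^ K * 0)) by (f_equal; ring).
      apply is_lim_seq_mult'; [apply is_lim_seq_const|].
      apply (is_lim_seq_incr_1 (fun n => q ^ n)). apply is_lim_seq_geom. rewrite Rabs_pos_eq; lra.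
Qed.

(** The ratio of the step to k + 1 is 4 q^(K+k+1): the part 4 q^(K+k) builds the weight, and the
    spare q builds q^k, kept to offset the growth of [hw]. *)
Lemma leg_tail_bound (q : R) (n K k : nat) : 0 < q < 1 -> 4 * q ^ S K <= 1 ->
  Rabs (leg q n (n + K + k)) <= tail_weight q K k * q ^ k.
Proof.
  intros Hq HK. induction k as [|k IH].
  - simpl. pose proof (leg_abs_le_one q n (n + K + 0) Hq). lra.
  - replace (n + K + S k)%nat with (S (n + K + k)) by lia.
    eapply Rle_trans; [apply (leg_tail_ratio q n (n + K + k) K); (assumption || lia)|].
    assert (0 < q ^ n) by (apply pow_lt; lra).
    assert (HP : 0 < q ^ (K + S k)) by (apply pow_lt; lra).
    replace (q ^ S (n + K + k) / q ^ n) with (q ^ (K + S k)).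
    2: { replace (S (n + K + k)) with (n + (K + S k))%nat by lia. rewrite (pow_add q n). field. lra. }
    eapply Rle_trans; [apply Rmult_le_compat_l; [lra|exact IH]|].
    simpl tail_weight. rewrite !pow_add. simpl. right; ring.
Qed.

Lemma hw_sum (q : R) (N : nat) : 0 < q < 1 ->
  sum_f_R0 (hw q) N = (1 - q ^ S N) ^ 2 / (q ^ N * (1 - q) ^ 2).
Proof.
  intros Hq. induction N as [|N IH].
  - simpl. unfold hw. simpl. field. lra.
  - rewrite tech5, IH. unfold hw. assert (0 < q ^ N) by (apply pow_lt; lra).
    replace (2 * S N + 1)%nat with (N + N + 3)%nat by lia. rewrite !pow_add. simpl. field. lra.
Qed.

Lemma Series_nonneg (a : nat -> R) : (forall i, 0 <= a i) -> ex_series a -> 0 <= Series a.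
Proof.
  intros Ha Hex.
  apply (is_lim_seq_le (fun _ => 0) (sum_n a) 0 (Series a)).
  - intros N. rewrite sum_n_Reals. apply cond_pos_sum, Ha.
  - apply is_lim_seq_const.
  - apply (Series_correct a Hex).
Qed.

Lemma leg_norm1_bound (q : R) (n K : nat) : 0 < q < 1 -> 4 * q ^ S K <= 1 ->
  Series (fun k => Rabs (leg q n k) * hw q k) <
  / q ^ K * (1 / (1 - q) + 1 / (1 - q ^ (2 * K + 1)) * Series (fun m => tail_weight q K (S m)))
    * (/ q ^ n * / (1 - q)).
Proof.
  intros Hq HK.
  (* Degrees up to n + K are estimated by |f_n| <= 1 and the closed sum of [hw], the others by the
     tail weights. *)
  rewrite (Series_incr_n _ (S (n + K))) by (lia || apply ex_series_leg1, Hq). simpl pred.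
  set (c := / q ^ (n + K) * / (1 - q)).
  assert (Hi : 0 < / (1 - q)) by (apply Rinv_0_lt_compat; lra).
  assert (HN : 0 < q ^ (n + K)) by (apply pow_lt; lra).
  assert (Hc : 0 < c) by (apply Rmult_lt_0_compat; [apply Rinv_0_lt_compat|]; lra).
  (* Strictness enters here, through the factor (1 - q^(n+K+1))^2 < 1 of the closed sum. *)
  assert (H1 : sum_f_R0 (fun k => Rabs (leg q n k) * hw q k) (n + K) < c * / (1 - q)).
  { apply Rle_lt_trans with (sum_f_R0 (hw q) (n + K)).
    - apply sum_Rle. intros k _. pose proof (leg_abs_le_one q n k Hq).
      destruct (hw_bounds q k Hq). nra.
    - rewrite hw_sum by assumption.
      assert (0 < q ^ S (n + K)) by (apply pow_lt; lra).
      assert (q ^ S (n + K) < 1) by (apply pow_lt_one; [lra|lia]).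
      replace ((1 - q ^ S (n + K)) ^ 2 / (q ^ (n + K) * (1 - q) ^ 2))
        with (c * / (1 - q) * (1 - q ^ S (n + K)) ^ 2) by (unfold c; field; lra).
      assert (0 < c * / (1 - q)) by (apply Rmult_lt_0_compat; assumption).
      assert ((1 - q ^ S (n + K)) ^ 2 < 1) by (simpl in *; nra). nra. }
  set (s := Series (fun m => tail_weight q K (S m))).
  assert (H2 : Series (fun k => Rabs (leg q n (S (n + K) + k)) * hw q (S (n + K) + k)) <= c * s).
  { unfold s. rewrite <- Series_scal_l. apply Series_le.
    - intros k. destruct (hw_bounds q (S (n + K) + k) Hq) as [P1 P2].
      pose proof (Rabs_pos (leg q n (S (n + K) + k))). split; [nra|].
      pose proof (leg_tail_bound q n K (S k) Hq HK) as B.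
      replace (n + K + S k)%nat with (S (n + K) + k)%nat in B by lia.
      replace (c * tail_weight q K (S k)) with
        (tail_weight q K (S k) * q ^ S k * (/ q ^ (S (n + K) + k) * / (1 - q))).
      + apply Rmult_le_compat; lra.
      + replace (S (n + K) + k)%nat with (n + K + S k)%nat by lia. rewrite (pow_add q (n + K)).
        unfold c. assert (0 < q ^ S k) by (apply pow_lt; lra). field. lra.
    - apply (ex_series_scal_l (K := R_AbsRing) (V := R_NormedModule) c).
      apply ex_series_tail_weight, Hq. }
  assert (H3 : 0 <= s).
  { apply Series_nonneg; [|apply ex_series_tail_weight, Hq].
    intros m. apply Rlt_le, tail_weight_pos, Hq. }
  assert (H4 : 1 <= 1 / (1 - q ^ (2 * K + 1))).
  { assert (q ^ (2 * K + 1) < 1) by (apply pow_lt_one; [lra|lia]).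
    assert (0 < q ^ (2 * K + 1)) by (apply pow_lt; lra).
    apply Rle_div_r; lra. }
  set (d := 1 / (1 - q ^ (2 * K + 1))) in *.
  replace (/ q ^ K * (1 / (1 - q) + d * s) * (/ q ^ n * / (1 - q))) with (c * / (1 - q) + c * (d * s)).
  - assert (c * s <= c * (d * s)) by (apply Rmult_le_compat_l; [lra|nra]). lra.
  - unfold c. rewrite pow_add. assert (0 < q ^ n) by (apply pow_lt; lra).
    assert (0 < q ^ K) by (apply pow_lt; lra). field. lra.
Qed.

(** * Strict comparison of the two norms *)

Lemma leg_nonzero (q : R) (n M : nat) : 0 < q < 1 ->
  exists k, (M <= k)%nat /\ leg q n k <> 0.
Proof.
  intros Hq. destruct (Req_dec (leg q n M) 0) as [H|H]; [|exists M; split; [lia|assumption]].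
  destruct (Req_dec (leg q n (S M)) 0) as [H'|H']; [|exists (S M); split; [lia|assumption]].
  (* Two consecutive zeros would propagate down to degree 0, where R_0 = 1. *)
  exfalso. induction M as [|M IH].
  - unfold leg, qLeg in H. simpl in H. lra.
  - apply IH; [|assumption]. pose proof (leg_rec q n M Hq) as E. rewrite H, H' in E.
    destruct (gq_bounds q M Hq). nra.
Qed.

Lemma Series_lt_nonneg (a b : nat -> R) (k : nat) :
  (forall i, a i <= b i) -> a k < b k -> ex_series a -> ex_series b -> Series a < Series b.
Proof.
  intros Hle Hlt Ha Hb.
  assert (Hd : ex_series (fun i => b i - a i))
    by (apply (ex_series_minus (K := R_AbsRing) (V := R_NormedModule)); assumption).
  enough (0 < Series b - Series a) by lra.
  rewrite <- Series_minus by assumption.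
  apply Rlt_le_trans with (b k - a k); [lra|].
  apply Rle_trans with (sum_f_R0 (fun i => b i - a i) k).
  - apply (sum_ge_term (fun i => b i - a i)); [|lia]. intros i. specialize (Hle i). lra.
  - rewrite (Series_incr_n (fun i => b i - a i) (S k)) by (lia || assumption). simpl pred.
    enough (0 <= Series (fun i => b (S k + i)%nat - a (S k + i)%nat)) by lra.
    apply (Series_nonneg (fun i => b (S k + i)%nat - a (S k + i)%nat)).
    + intros i. specialize (Hle (S k + i)%nat). lra.
    + apply (ex_series_incr_n (fun i => b i - a i) (S k)), Hd.
Qed.

Lemma leg_norm2 (q : R) (n : nat) : 0 < q < 1 ->
  norm2 q (alpha q (1 - q ^ n)) ^ 2 = / q ^ n * / (1 - q).
Proof.
  intros Hq. unfold norm2.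
  assert (E : lsum2 q (alpha q (1 - q ^ n)) = / q ^ n * / (1 - q)).
  { rewrite <- inner_self by assumption. unfold lsum2, inner. apply Series_ext. intros k.
    rewrite pow2_abs. change (alpha q (1 - q ^ n) k) with (leg q n k). ring. }
  rewrite E, pow2_sqrt; [reflexivity|].
  apply Rlt_le, Rmult_lt_0_compat; apply Rinv_0_lt_compat; [apply pow_lt; lra|lra].
Qed.

Lemma ex_series_leg_sq (q : R) (n : nat) : 0 < q < 1 ->
  ex_series (fun k => Rabs (leg q n k) ^ 2 * hw q k).
Proof.
  intros Hq. apply (ex_series_ext (fun k => hw q k * (leg q n k * leg q n k))).
  - intros k. rewrite pow2_abs. simpl. rewrite Rmult_1_r. apply Rmult_comm.
  - apply ex_series_leg2, Hq.
Qed.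

(** Termwise |f|^2 <= |f|; far out |f| < 1, and a nonzero value there makes one term strict. *)
Lemma norm2_lt_norm1 (q : R) (n : nat) : 0 < q < 1 ->
  norm2 q (alpha q (1 - q ^ n)) ^ 2 < norm1 q (alpha q (1 - q ^ n)).
Proof.
  intros Hq.
  assert (E : norm2 q (alpha q (1 - q ^ n)) ^ 2 = Series (fun k => Rabs (leg q n k) ^ 2 * hw q k)).
  { rewrite leg_norm2, <- inner_self by assumption. apply Series_ext. intros k.
    rewrite pow2_abs. ring. }
  rewrite E. change (norm1 q (alpha q (1 - q ^ n))) with (Series (fun k => Rabs (leg q n k) * hw q k)).
  pose proof (leg_lim_k q n Hq) as L. apply is_lim_seq_spec in L.
  destruct (L (mkposreal 1 Rlt_0_1)) as [M HM].
  destruct (leg_nonzero q n M Hq) as [k [Hk Hnz]].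
  apply (Series_lt_nonneg _ _ k).
  - intros i. pose proof (leg_abs_le_one q n i Hq). pose proof (Rabs_pos (leg q n i)).
    destruct (hw_bounds q i Hq). apply Rmult_le_compat_r; [lra|simpl; nra].
  - specialize (HM k Hk). simpl in HM. rewrite Rminus_0_r in HM.
    pose proof (Rabs_pos_lt _ Hnz).
    destruct (hw_bounds q k Hq). apply Rmult_lt_compat_r; [lra|simpl; nra].
  - apply ex_series_leg_sq, Hq.
  - apply ex_series_leg1, Hq.
Qed.

(** * The explicit constant and the conclusion *)

Lemma Kq_spec (q : R) : 0 < q < 1 ->
  exists K : nat, IZR (Kq q) = INR K /\ 4 * q ^ S K <= 1.
Proof.
  intros Hq. unfold Kq, Rceil. set (x := ln 4 / ln (1 / q) - 1).
  assert (L4 : 0 < ln 4) by (rewrite <- ln_1; apply ln_increasing; lra).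
  assert (Lq : 0 < ln (1 / q)).
  { rewrite <- ln_1. apply ln_increasing; [lra|]. apply Rlt_div_r; lra. }
  assert (Hx : -1 < x).
  { unfold x. assert (0 < ln 4 / ln (1 / q)) by (apply Rdiv_lt_0_compat; assumption). lra. }
  (* The bounds -x < [up (- x)] <= -x + 1 give x <= z < x + 1, so z is the ceiling of x; x > -1 then
     yields z >= 0. *)
  destruct (archimed (- x)) as [A1 A2].
  set (z := (1 - up (- x))%Z).
  assert (Hz : IZR z = 1 - IZR (up (- x))) by (unfold z; rewrite minus_IZR; reflexivity).
  assert (Hz0 : (0 <= z)%Z).
  { apply Z.lt_succ_r, lt_IZR. rewrite succ_IZR. lra. }
  exists (Z.to_nat z). split; [rewrite INR_IZR_INZ, Z2Nat.id by assumption; reflexivity|].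
  rewrite <- Rpower_pow by lra. unfold Rpower.
  rewrite S_INR, INR_IZR_INZ, Z2Nat.id by assumption.
  replace (ln q) with (- ln (1 / q)).
  2: { unfold Rdiv. rewrite Rmult_1_l, ln_Rinv by lra. ring. }
  (* In logarithms, 4 q^(K+1) <= 1 reads exactly like this, which is K >= x. *)
  assert (Hl : ln 4 <= (IZR z + 1) * ln (1 / q)).
  { replace (ln 4) with ((x + 1) * ln (1 / q)) by (unfold x; field; lra).
    apply Rmult_le_compat_r; lra. }
  apply Rle_trans with (4 * exp (- ln 4)).
  - apply Rmult_le_compat_l; [lra|].
    destruct (Rle_lt_or_eq_dec _ _ Hl) as [Hl'|Hl'].
    + apply Rlt_le, exp_increasing. lra.
    + right. f_equal. lra.
  - rewrite exp_Ropp, exp_ln by lra. lra.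
Qed.

Lemma Cq_eq (q : R) (K : nat) : 0 < q < 1 -> IZR (Kq q) = INR K ->
  Cq q = / q ^ K * (1 / (1 - q) + 1 / (1 - q ^ (2 * K + 1)) * Series (fun m => tail_weight q K (S m))).
Proof.
  intros Hq HK. unfold Cq. rewrite HK, Rpower_pow by lra.
  replace (2 * INR K + 1) with (INR (2 * K + 1)) by (rewrite plus_INR, mult_INR; simpl; ring).
  rewrite Rpower_pow by lra. do 3 f_equal.
  apply Series_ext. intros m. apply tail_weight_Rpower, Hq.
Qed.

Theorem theorem2p1 (q : R) (hq0 : 0 < q) (hq1 : q < 1) :
  (exists C : R, 0 < C /\
     forall n : nat,
       let f := alpha q (1 - q ^ n) in
       0 < norm2 q f ^ 2 /\ norm2 q f ^ 2 < norm1 q f /\ norm1 q f < C * norm2 q f ^ 2) /\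
  (0 < Cq q /\
     forall n : nat,
       let f := alpha q (1 - q ^ n) in
       ex_series (fun k => Rabs (f k) * hw q k) /\
       ex_series (fun k => Rabs (f k) ^ 2 * hw q k) /\
       0 < norm2 q f ^ 2 /\ norm2 q f ^ 2 < norm1 q f /\ norm1 q f < Cq q * norm2 q f ^ 2).
Proof.
  assert (Hq : 0 < q < 1) by lra.
  destruct (Kq_spec q Hq) as [K [HK HK4]].
  assert (H : forall n,
    0 < norm2 q (alpha q (1 - q ^ n)) ^ 2 /\
    norm2 q (alpha q (1 - q ^ n)) ^ 2 < norm1 q (alpha q (1 - q ^ n)) /\
    norm1 q (alpha q (1 - q ^ n)) < Cq q * norm2 q (alpha q (1 - q ^ n)) ^ 2).
  { intros n. split; [|split].
    - rewrite leg_norm2 by assumption.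
      apply Rmult_lt_0_compat; apply Rinv_0_lt_compat; [apply pow_lt; lra|lra].
    - apply norm2_lt_norm1, Hq.
    - rewrite leg_norm2, (Cq_eq q K) by assumption. apply leg_norm1_bound; assumption. }
  assert (HC : 0 < Cq q).
  { destruct (H 0%nat) as [H1 [H2 H3]]. nra. }
  split.
  - exists (Cq q). split; [exact HC|exact H].
  - split; [exact HC|]. intros n f. split; [|split; [|apply H]].
    + apply (ex_series_leg1 q n Hq).
    + apply (ex_series_leg_sq q n Hq).
Qed.
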